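(* For all $n\ge2$ and $1\le k\le n-1$, $$t^k\,\underline{\mathrm{H}}_{\mathrm{U}_{n-k,n}}(t)=\sum_{e\in\mathcal{D}^k_n}t^{\mathrm{asc}(e)}.$$
   Context: Uniform matroids: for $1\le r\le n$, $\mathrm{U}_{r,n}$ is the matroid on $[n]=\{1,\dots,n\}$ whose flats are $[n]$ and all subsets of $[n]$ of cardinality at most $r-1$. Chow polynomial: for a loopless matroid $\mathrm{M}$ on a finite set $E$ with lattice of flats $\mathcal{L}(\mathrm{M})$, the Chow ring is the graded algebra $\underline{\mathrm{CH}}(\mathrm{M})=\mathbb{Q}[x_F,\ F\in\mathcal{L}(\mathrm{M})\setminus\{\emptyset\}]/(\mathcal{I}+\mathcal{J})$ (generators in degree $1$), where $\mathcal{I}$ is generated by $\sum_{F\in\mathcal{L}(\mathrm{M}),\,F\ni i}x_F$ for all $i\in E$, and $\mathcal{J}$ by the products $x_{F_1}x_{F_2}$ for all pairs of incomparable nonempty flats $F_1,F_2$. Its Hilbert series is $\underline{\mathrm{H}}_{\mathrm{M}}(t)=\sum_k\dim_{\mathbb{Q}}\underline{\mathrm{CH}}^k(\mathrm{M})\,t^k$. Inversion sequences: $\mathcal{I}_n$ is the set of integer sequences $e=(e_i)_{1\le i\le n}$ with $0\le e_i\le i-1$. $\mathrm{asc}(e)$ is the number of $i\le n-1$ with $e_i<e_{i+1}$. $\mathcal{D}_n\subset\mathcal{I}_n$ is the set of $e$ such that $e_n\ne0$ and there is no $i$ with $e_i=e_{i+1}=0$. For $n\ge2$ and $e\in\mathcal{I}_n$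 with $e_2=1$, let $\mathsf{fz}(e)$ be the smallest index $i\ge2$ with $e_i=0$ if it exists, and $\mathsf{fz}(e)=n+1$ otherwise; let $\mathsf{fp}(e)\in\mathcal{I}_{\mathsf{fz}(e)-2}$ be the inversion sequence $\mathsf{fp}(e)_i=e_{i+1}-1$ for $1\le i\le\mathsf{fz}(e)-2$. The sets $\mathcal{D}^k_n\subset\mathcal{I}_n$ are defined inductively: $\mathcal{D}^1_n=\mathcal{D}_n$ for all $n\ge1$ (with $\mathcal{D}^1_1=\emptyset$); for $2\le k\le n$, $\mathcal{D}^k_n$ is the set of $e\in\mathcal{I}_n$ such that $e\in\mathcal{D}^1_n$ and $\mathsf{fp}(e)\in\mathcal{D}^{k-1}_{\mathsf{fz}(e)-2}$, where $\mathcal{D}^{j}_{l}$ is understood to be empty when $j>l$. (Note that $e\in\mathcal{D}_n$ with $n\ge 2$ forces $e_2=1$.) *)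

(* Defs.v *)
From HB Require Import structures.
From mathcomp Require Import all_boot all_order all_algebra generic_quotient
  ring_quotient.
From mathcomp Require Import boolp.
From mathcomp Require Import mpoly.

Set Implicit Arguments.
Unset Strict Implicit.
Unset Printing Implicit Defensive.

Import GRing.Theory.

Local Open Scope ring_scope.
Local Open Scope quotient_scope.

Section Matroids.
Variable E : finType.
Implicit Types (L : {set {set E}}) (F G : {set E}).

Definition covers L F G :=
  [&& F \in L, G \in L, F \proper G &
      [forall H in L, ~~ ((F \proper H) && (H \proper G))]].

(* The last axiom says that the sets [G :\: F], for [G] a flat covering the
   flat [F], partition the complement of [F]. *)
Record matroid := Matroid {
  flats : {set {set E}};
  flatsT : [set: E] \in flats;
  flatsI : forall F G, F \in flats -> G \in flats -> F :&: G \in flats;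
  flats_cover : forall F x, F \in flats -> x \notin F ->
    exists! G : {set E}, covers flats F G /\ x \in G
}.

Definition loopless (M : matroid) := set0 \in flats M.

Definition nonempty_flats (M : matroid) : {set {set E}} := flats M :\ set0.

End Matroids.

Section UniformMatroid.
Variables r n : nat.

Definition uniform_flats : {set {set 'I_n}} :=
  [set F : {set 'I_n} | (F == [set: 'I_n]) || (#|F| < r)%N].

Lemma uniform_flatsT : [set: 'I_n] \in uniform_flats.
Proof. by rewrite inE eqxx. Qed.

Lemma uniform_flatsI (F G : {set 'I_n}) :
  F \in uniform_flats -> G \in uniform_flats -> F :&: G \in uniform_flats.
Proof.
rewrite !inE => /orP[/eqP-> | ltF]; first by rewrite setTI.
move=> _; apply/orP; right; apply: leq_ltn_trans ltF.
exact/subset_leq_card/subsetIl.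
Qed.

Lemma uniform_flats_cover (F : {set 'I_n}) x :
    F \in uniform_flats -> x \notin F ->
  exists! G : {set 'I_n}, covers uniform_flats F G /\ x \in G.
Proof.
move=> FL xF.
have FT : F != setT by apply: contraNneq xF => ->; rewrite inE.
have ltFr : (#|F| < r)%N by move: FL; rewrite inE (negPf FT).
have cardxF : #|x |: F| = #|F|.+1 by rewrite cardsU1 xF.
have Fpr : F \proper x |: F by rewrite properUr // sub1set.
case: (ltnP #|F|.+1 r) => [lt1 | ge1].
- exists (x |: F); split; first split.
  + apply/and4P; split=> //; first by rewrite inE cardxF lt1 orbT.
    apply/forallP => H; apply/implyP => _; apply/negP => /andP[/proper_card l1].
    by move=> /proper_card; rewrite cardxF ltnS leqNgt l1.
  + by rewrite !inE eqxx.
  move=> G [/and4P[_ GL FG /forallP/(_ (x |: F))]].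
  rewrite inE cardxF lt1 orbT Fpr /= => nG xG.
  apply/eqP; move: nG; rewrite properEneq; case: eqP => //= _.
  by rewrite subUset sub1set xG (proper_sub FG).
- have big H : H \in uniform_flats -> F \proper H -> H = setT.
    rewrite inE => /orP[/eqP // | ltH] /proper_card FH.
    by move: (leq_trans FH (leq_trans ltH ge1)); rewrite ltnn.
  exists setT; split; first split; rewrite ?inE //.
  + apply/and4P; split=> //; rewrite ?uniform_flatsT ?properT //.
    apply/forallP => H; apply/implyP => HL; apply/negP => /andP[FH].
    by rewrite (big _ HL FH) properxx.
  by move=> G [/and4P[_ GL FG _] _]; rewrite (big _ GL FG).
Qed.

(* [uniform_matroid r n] is U_{r,n}; the ground set [n] is shifted to
   {0, ..., n-1}. *)
Definition uniform_matroid : matroid 'I_n :=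
  Matroid uniform_flatsT uniform_flatsI uniform_flats_cover.

Lemma uniform_loopless : (0 < r)%N -> loopless uniform_matroid.
Proof. by move=> r0; rewrite /loopless inE cards0 r0 orbT. Qed.

End UniformMatroid.

Definition ideal_generated (R : comNzRingType) (s : seq R) : pred R :=
  fun p => `[< exists c : 'I_(size s) -> R, p = \sum_i c i * s`_i >].

Section ChowRing.
Variables (E : finType) (M : matroid E).

(* The variable ['X_i] stands for x_F, where [F = chow_flat i]. *)
Definition chow_polyring := {mpoly rat[#|nonempty_flats M|]}.

Definition chow_flat (i : 'I_#|nonempty_flats M|) : {set E} := enum_val i.

Definition linear_relations : seq chow_polyring :=
  [seq \sum_(i | e \in chow_flat i) 'X_i | e : E].

Definition incomparable (F G : {set E}) := ~~ (F \subset G) && ~~ (G \subset F).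

Definition quadratic_relations : seq chow_polyring :=
  [seq 'X_ij.1 * 'X_ij.2 |
     ij : 'I_#|nonempty_flats M| * 'I_#|nonempty_flats M| in
       [pred ij | incomparable (chow_flat ij.1) (chow_flat ij.2)]].

Definition chow_ideal : pred chow_polyring :=
  ideal_generated (linear_relations ++ quadratic_relations).

Lemma chow_ideal_idealr_closed : idealr_closed chow_ideal.
Proof.
set s := linear_relations ++ quadratic_relations.
have meval0 p : p \in s -> p.@[fun=> 0] = 0.
  rewrite mem_cat => /orP[] /mapP[i _ ->].
  - by rewrite rmorph_sum big1 // => j _; rewrite /= mevalXU.
  - by rewrite rmorphM /= !mevalXU mul0r.
split.
- by apply/asboolP; exists (fun=> 0); rewrite big1 // => i _; rewrite mul0r.
- apply/asboolP => -[c] /(congr1 (meval (fun=> 0))).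
  rewrite rmorph1 rmorph_sum big1 => [/eqP|i _]; first by rewrite oner_eq0.
  by rewrite rmorphM /= (meval0 _ (mem_nth 0 (ltn_ord i))) mulr0.
- move=> a p q /asboolP[c ->] /asboolP[d ->]; apply/asboolP.
  exists (fun i => a * c i + d i); rewrite mulr_sumr -big_split /=.
  by apply: eq_bigr => i _; rewrite mulrDl mulrA.
Qed.

HB.instance Definition _ :=
  isIdealr.Build chow_polyring chow_ideal chow_ideal_idealr_closed.

Definition chow_idealr : idealr chow_polyring := chow_ideal.

Definition chow_ring := {ideal_quot chow_idealr}.

HB.instance Definition _ := GRing.ComNzRing.on chow_ring.

Definition chow_proj (p : chow_polyring) : chow_ring :=
  \pi_({ideal_quot chow_idealr}) p.

Definition chow_scale (a : rat) (x : chow_ring) : chow_ring :=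
  chow_proj a%:MP * x.

Lemma chow_projM p q : chow_proj (p * q) = chow_proj p * chow_proj q.
Proof. exact: (rmorphM \pi_({ideal_quot chow_idealr})). Qed.

Lemma chow_projD p q : chow_proj (p + q) = chow_proj p + chow_proj q.
Proof. exact: (raddfD \pi_({ideal_quot chow_idealr})). Qed.

Lemma chow_proj1 : chow_proj 1 = 1.
Proof. exact: (rmorph1 \pi_({ideal_quot chow_idealr})). Qed.

Lemma chow_scaleA a b x : chow_scale a (chow_scale b x) = chow_scale (a * b) x.
Proof. by rewrite /chow_scale mpolyCM chow_projM mulrA. Qed.

Lemma chow_scale1 : left_id 1 chow_scale.
Proof. by move=> x; rewrite /chow_scale mpolyC1 chow_proj1 mul1r. Qed.

Lemma chow_scaleDr : right_distributive chow_scale +%R.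
Proof. by move=> a x y; rewrite /chow_scale mulrDr. Qed.

Lemma chow_scaleDl x : {morph chow_scale^~ x : a b / a + b}.
Proof. by move=> a b; rewrite /chow_scale mpolyCD chow_projD mulrDl. Qed.

HB.instance Definition _ := GRing.Zmodule_isLmodule.Build rat chow_ring
  chow_scaleA chow_scale1 chow_scaleDr chow_scaleDl.

Lemma chow_scaleAl (a : rat) (x y : chow_ring) : a *: (x * y) = (a *: x) * y.
Proof. exact: mulrA. Qed.

HB.instance Definition _ :=
  GRing.Lmodule_isLalgebra.Build rat chow_ring chow_scaleAl.

HB.instance Definition _ := GRing.Lalgebra_isComAlgebra.Build rat chow_ring.

Definition chow_graded (d : nat) (x : chow_ring) : Prop :=
  exists2 p : chow_polyring, p \is d.-homog & x = chow_proj p.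

End ChowRing.

(* Meant for [S] a linear subspace of V; V itself need not be
   finite-dimensional. *)
Definition has_dim (K : fieldType) (V : lmodType K) (S : V -> Prop) (d : nat) :=
  exists b : 'I_d -> V, (forall i, S (b i)) /\
    forall v, S v -> exists! c : 'rV[K]_d, v = \sum_i c 0 i *: b i.

Lemma has_dim_unique (K : fieldType) (V : lmodType K) (S : V -> Prop) d1 d2 :
  has_dim S d1 -> has_dim S d2 -> d1 = d2.
Proof.
suff le m n : has_dim S m -> has_dim S n -> (m <= n)%N.
  by move=> h1 h2; apply/eqP; rewrite eqn_leq !le.
move=> [b [Sb bP]] [b' [Sb' bP']].
have /choice[A AP] i : exists c : 'rV[K]_n, b i = \sum_j c 0 j *: b' j.
  by have [c [? _]] := bP' _ (Sb i); exists c.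
have /choice[B BP] i : exists c : 'rV[K]_m, b' i = \sum_j c 0 j *: b j.
  by have [c [? _]] := bP _ (Sb' i); exists c.
have AB1 : (\matrix_i A i) *m (\matrix_j B j) = 1%:M.
  apply/row_matrixP => i; have [c [_ cU]] := bP _ (Sb i).
  rewrite -[LHS]cU -?[RHS]cU //.
    rewrite (bigD1 i) //= big1 ?addr0 => [|j ji].
      by rewrite !mxE eqxx scale1r.
    by rewrite !mxE eq_sym (negPf ji) scale0r.
  rewrite [LHS]AP; under eq_bigr do rewrite BP scaler_sumr.
  rewrite exchange_big; apply: eq_bigr => k _; rewrite !mxE scaler_suml.
  by apply: eq_bigr => j _; rewrite scalerA !mxE.
have := mxrankM_maxl (\matrix_i A i) (\matrix_j B j).
by rewrite AB1 mxrank1 => /leq_trans; apply; apply: rank_leq_col.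
Qed.

(* The coefficients of a Hilbert series are dimensions, hence in [nat]. *)
Definition is_hilbert_series (E : finType) (M : matroid E) (H : {poly nat}) :=
  forall d, has_dim (@chow_graded E M d) (H`_d)%R.

Lemma hilbert_series_unique (E : finType) (M : matroid E) (H1 H2 : {poly nat}) :
  is_hilbert_series M H1 -> is_hilbert_series M H2 -> H1 = H2.
Proof. by move=> h1 h2; apply/polyP => d; apply: has_dim_unique (h1 d) (h2 d). Qed.

(* A sequence e = (e_1, ..., e_n) is a [seq nat] of size [n], indexed from 0:
   e_i is [nth 0 e i.-1]. *)
Section InversionSequences.
Local Open Scope nat_scope.
Implicit Type e : seq nat.

Definition is_invseq e := [forall i : 'I_(size e), nth 0 e i <= i].

Definition asc e := #|[set i : 'I_(size e).-1 | nth 0 e i < nth 0 e i.+1]|.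

(* For the empty sequence [last 0 e] is 0, so no sequence of size 0 is in D. *)
Definition in_D e :=
  [&& is_invseq e, last 0 e != 0 &
      [forall i : 'I_(size e).-1, ~~ ((nth 0 e i == 0) && (nth 0 e i.+1 == 0))]].

(* [behead e] is (e_2, ..., e_n), and [find] returns its size when no entry
   is 0. *)
Definition fz e := (find (pred1 0) (behead e)).+2.

Definition fp e := [seq x.-1 | x <- take (fz e - 2) (behead e)].

(* [in_Dk k e] says that e is in D^k_n, for n = size e. *)
Fixpoint in_Dk k e :=
  match k with
  | 0 => false
  | 1 => in_D e
  | k'.+1 => [&& k <= size e, in_D e & in_Dk k' (fp e)]
  end.

(* The entries of an inversion sequence of size n are less than n, so D^k_n is
   a finite set of n-tuples with entries in ['I_n]. *)
Definition Dk n k : {set n.-tuple 'I_n} :=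
  [set e : n.-tuple 'I_n | in_Dk k [seq val x | x <- e]].

End InversionSequences.

(* Main.v *)
Require Import Defs.
From HB Require Import structures.
From mathcomp Require Import all_boot all_order all_algebra.
From mathcomp Require Import generic_quotient ring_quotient boolp mpoly ring zify.

(* Write h_A for the sum of the x_F over the flats F containing A. The relations
   become h_A = 0 for A of rank 1 and (h_A - h_J) (h_B - h_J) = 0 for J = A u B,
   and imply h_A h_B^c = h_B^(c+1) for A inside B and c >= rk B - rk A, and
   h_B^(rk B) = 0. Read from left to right these enlarge the sets involved, so
   the monomials in the h_F supported on chains with exponents bounded as in the
   Feichtner-Yuzvinsky basis span. Their independence is seen by pairing them
   with the degree maps of products of minors along chains: on monomials in the
   h_F these take the values 0 and 1 according to a dragon marriage condition,
   they vanish on the relations because rank is submodular, and the resulting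
   matrix is unitriangular.

   Counting these monomials gives H_(U_(r,n)) = sum_(j < r) C(n,j) d_j [r-j]_t,
   with d_j the derangement polynomials. On the other side, cutting e in D_n^k
   at its first zero after e_1 gives P_n^k = t sum_m V_(m+2) P_m^(k-1), where
   P_n^k is the sum of t^asc over D_n^k and V_p = V_p^(n) weighs the tails
   starting with a zero at position p, with V_(n+1) = 1. The V_p satisfy
   sum_p (V_p + t V_(p+1)) w^(p-1) = t sum_q (V_q + V_(q+1)) (w + 1 - t)^(q-1).
   For the Appell polynomials R_m(z) = sum_i C(m,i) d_(m-i) z^i of the
   derangement polynomials this amounts to z sum_m V_(m+2) R_m(z) = R_n(z) - V_1,
   whose coefficients say that V_1 = d_n and that H_(U_(n-k,n)) satisfies the
   same recursion in k as t^(-k) P_n^k. *)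

Set Implicit Arguments.
Unset Strict Implicit.
Unset Printing Implicit Defensive.

Import GRing.Theory.

Local Open Scope ring_scope.

(** * Derangement polynomials *)

Lemma coef_XaddCn (D : comNzRingType) (c : D) i k :
  (('X + c%:P) ^+ i)`_k = c ^+ (i - k) *+ 'C(i, k).
Proof.
rewrite addrC exprDn coef_sum.
have E (j : 'I_i.+1) : ((c%:P ^+ (i - j) * 'X ^+ j) *+ 'C(i, j))`_k =
    if j == k :> nat then c ^+ (i - k) *+ 'C(i, k) else 0.
  rewrite coefMn -polyC_exp mulrC coefXnM coefC.
  case: ltngtP => [lt|gt|->]; rewrite ?mul0rn ?subnn //.
  by rewrite subn_eq0 leqNgt gt mul0rn.
rewrite (eq_bigr _ (fun j _ => E j)) -big_mkcond /=.
case: (ltnP k i.+1) => [lt|gt].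
  by rewrite (big_pred1 (Ordinal lt)).
rewrite big_pred0 ?bin_small ?mulr0n // => j.
by apply/negbTE; have := ltn_ord j; lia.
Qed.

(** Both sides are the multinomial coefficient n! / (i! k! (n - i - k)!). *)
Lemma bin_mul_symm n i k : (i + k <= n)%N ->
  ('C(n - i, k) * 'C(n, i) = 'C(n - k, i) * 'C(n, k))%N.
Proof.
move=> le; have f0 := fact_gt0.
apply/eqP; rewrite -(eqn_pmul2r (f0 i)) -(eqn_pmul2r (f0 k)).
rewrite -(eqn_pmul2r (f0 (n - i - k)%N)); apply/eqP.
have Ei := @bin_fact n i; have Ek := @bin_fact n k.
have Eik := @bin_fact (n - i) k; have Eki := @bin_fact (n - k) i.
transitivity n`!; first by rewrite -Ei -?Eik; [ring | lia | lia].
have -> : (n - i - k = n - k - i)%N by lia.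
by rewrite -Ek -?Eki; [ring | lia | lia].
Qed.

Section DerangementPolynomials.
Variables (D : comNzRingType) (t : D).

Definition geom n := \sum_(a < n) t ^+ a.

Lemma geomE n : (1 - t) * geom n = 1 - t ^+ n.
Proof. by rewrite -[1 - t]opprB mulNr -subrX1 opprB. Qed.

(** The recurrence uses all smaller values, hence the fuel [k]; once [k] is at least n the value is
    stable and the default 0 is never reached. *)
Fixpoint der_fuel k n : D :=
  if n is 0 then 1 else
  if k is k'.+1 then
    \sum_(i < n) (der_fuel k' i * (t * geom (n - i).-1)) *+ 'C(n, i)
  else 0.

(* The generating polynomial of derangements of [n] by excedances. *)
Definition der n := der_fuel n n.

Lemma der0 : der 0 = 1. Proof. by []. Qed.

Lemma derE n : (0 < n)%N ->
  der n = \sum_(i < n) (der i * (t * geom (n - i).-1)) *+ 'C(n, i).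
Proof.
have fuel k j : (j <= k)%N -> der_fuel k j = der j.
  rewrite /der; elim: k {-2}k (leqnn k) j => [|b IH] k leb j.
    by move: leb; rewrite leqn0 => /eqP->; case: j.
  case: j k leb => [|j] [|k] // leb lejk.
  rewrite /=; apply: eq_bigr => i _.
  by have lti := ltn_ord i; rewrite (IH k) ?(IH j) //; lia.
case: n => // n _; rewrite /der /=.
by apply: eq_bigr => i _; rewrite fuel // -ltnS.
Qed.

(** Coefficient of w^n / n! in (e^(t w) - t e^w) d(w) = 1 - t, with d(w) the exponential generating
    function of the [der n]. For n > 0 the summand i = n is (1 - t) d_n, which [derE] cancels
    against the rest. *)
Lemma der_umbral n :
  \sum_(i < n.+1) (der i * (t ^+ (n - i) - t)) *+ 'C(n, i)
    = (1 - t) *+ (n == 0)%N.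
Proof.
case: n => [|n]; first by rewrite big_ord1 der0 mul1r.
rewrite big_ord_recr /= subnn binn (derE (ltn0Sn n)) expr0 mulr1n mulr0n.
rewrite mulr_suml -big_split big1 // => i _ /=.
rewrite mulrnAl -mulrnDl.
have -> : (n.+1 - i = (n.+1 - i).-1.+1)%N by have := ltn_ord i; lia.
have /(congr1 (fun x => 1 - x)) := geomE (n.+1 - i).-1.
rewrite subKr exprS /= => <-.
by rewrite -[RHS](mul0rn _ 'C(n.+1, i)); congr (_ *+ _); ring.
Qed.

(* Counts all permutations of [n], with fixed points marked by X. *)
Definition der_appell n : {poly D} :=
  \sum_(i < n.+1) (der (n - i) *+ 'C(n, i)) *: 'X^i.

Lemma coef_der_appell n i : (der_appell n)`_i = der (n - i) *+ 'C(n, i).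
Proof.
rewrite /der_appell -(poly_def _ (fun i => der (n - i) *+ 'C(n, i))) coef_poly.
by case: ltnP => // lt; rewrite bin_small.
Qed.

Definition shift (c : D) (f : {poly D}) := f \Po ('X + c%:P).

Lemma shift_is_linear c : linear (shift c).
Proof. exact: (linearP (comp_poly _)). Qed.
HB.instance Definition _ c :=
  GRing.isLinear.Build D {poly D} {poly D} _ (shift c) (shift_is_linear c).

Lemma shiftM c f g : shift c (f * g) = shift c f * shift c g.
Proof. exact: rmorphM. Qed.

Lemma shiftC c a : shift c a%:P = a%:P. Proof. exact: comp_polyC. Qed.

Lemma shiftX c : shift c 'X = 'X + c%:P. Proof. exact: comp_polyX. Qed.

Lemma shiftXn c n : shift c 'X^n = ('X + c%:P) ^+ n.
Proof. exact: comp_Xn_poly. Qed.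

Lemma shiftD c f g : shift c (f + g) = shift c f + shift c g.
Proof. exact: linearD. Qed.

Lemma shiftZ c a f : shift c (a *: f) = a *: shift c f.
Proof. exact: linearZ. Qed.

Lemma shift_shift c d f : shift c (shift d f) = shift (c + d) f.
Proof.
by rewrite /shift -comp_polyA comp_polyD comp_polyX comp_polyC polyCD addrA.
Qed.

(** Formally e^(t p) - t e^p with p = d/dX. Up to the factor 1 - t it inverts the operator d(p),
    which sends X^n to [der_appell n]. *)
Definition der_op f := shift t f - t *: shift 1 f.

Lemma der_op_is_linear : linear der_op.
Proof.
by move=> a f g; rewrite /der_op !linearP /= addrACA scalerBr scalerN.
Qed.
HB.instance Definition _ :=
  GRing.isLinear.Build D {poly D} {poly D} _ der_op der_op_is_linear.

Lemma der_opD f g : der_op (f + g) = der_op f + der_op g.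
Proof. exact: linearD. Qed.

Lemma der_opB f g : der_op (f - g) = der_op f - der_op g.
Proof. exact: linearB. Qed.

Lemma der_opZ a f : der_op (a *: f) = a *: der_op f.
Proof. exact: linearZ. Qed.

Lemma der_op_shift c f : der_op (shift c f) = shift c (der_op f).
Proof.
rewrite /der_op [RHS]linearB [in RHS]linearZ /= !shift_shift.
by rewrite [c + t]addrC [c + 1]addrC.
Qed.

(** The coefficient of X^k on the left is C(n, k) times the sum of [der_umbral] for n - k. *)
Lemma der_op_appell n : der_op (der_appell n) = (1 - t) *: 'X^n.
Proof.
apply/polyP => k; rewrite coefZ coefXn linear_sum coef_sum /=.
have E (i : 'I_n.+1) : (der_op ((der (n - i) *+ 'C(n, i)) *: 'X^i))`_k =
    (der (n - i) * (t ^+ (i - k) - t)) *+ ('C(i, k) * 'C(n, i)).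
  rewrite linearZ /= /der_op !shiftXn coefZ coefB coefZ !coef_XaddCn.
  by rewrite expr1n mulrnAr -mulrnBl mulrnAr mulrnAl -mulrnA mulnC mulr1.
rewrite (eq_bigr _ (fun i _ => E i)).
case: (ltnP n k) => [lt|le].
  rewrite [k == n]gtn_eqF // mulr0 big1 // => i _.
  by rewrite bin_small ?mul0n ?mulr0n //; have := ltn_ord i; lia.
have := der_umbral (n - k) => U.
rewrite (reindex_inj rev_ord_inj) /=.
have lenk : ((n - k).+1 <= n.+1)%N by rewrite ltnS leq_subr.
transitivity (\sum_(i < (n - k).+1)
   ((der i * (t ^+ (n - k - i) - t)) *+ 'C(n - k, i)) *+ 'C(n, k)).
  rewrite (big_ord_widen n.+1 (fun i => (der i *
    (t ^+ (n - k - i) - t)) *+ 'C(n - k, i) *+ 'C(n, k)) lenk).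
  rewrite [RHS]big_mkcond; apply: eq_bigr => i _ /=.
  have lein : (i <= n)%N by rewrite -ltnS.
  rewrite subSS subKn // bin_sub //.
  case: ltnP => [lti|gei]; last by rewrite bin_small ?mul0n ?mulr0n //; lia.
  rewrite bin_mul_symm; last by lia.
  have -> : (n - i - k = n - k - i)%N by lia.
  exact: mulrnA.
rewrite sumrMnl U subn_eq0 mulr_natr -mulrnA.
case: (ltngtP n k) le => //= -> _.
by rewrite binn.
Qed.

End DerangementPolynomials.

(** Shifts keep the degree and the leading coefficient, so [der_op] multiplies the latter by 1 -
    t. *)
Lemma der_op_inj (D : idomainType) (t : D) : t != 1 -> injective (der_op t).
Proof.
move=> t1; apply: raddf_inj => f f0; apply: contraTeq isT => nz.
have sz c : size ('X + c%:P : {poly D}) = 2%N by rewrite size_XaddC.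
have lc c : (shift c f)`_(size f).-1 = lead_coef f.
  rewrite -[(size f).-1](congr1 predn (size_comp_poly2 f (sz c))).
  rewrite -[LHS]/(lead_coef (f \Po ('X + c%:P))) lead_coef_comp ?sz //.
  by rewrite lead_coefXaddC expr1n mulr1.
have := congr1 (fun p : {poly D} => p`_(size f).-1) f0.
rewrite /der_op coefB coefZ !lc coef0 -{1}[lead_coef f]mul1r -mulrBl => /eqP.
by rewrite mulf_eq0 lead_coef_eq0 (negPf nz) orbF subr_eq0 eq_sym (negPf t1).
Qed.

(* With (1 - t) u = der_op Y, the equation for V reads der_op (lhs of Q0) = 0,
   and the left-hand side of Q0 is der_op of the claimed difference. *)
Lemma shift_equation_solution (D : idomainType) (t : D) (t1 : t != 1)
    (n : nat) (V : nat -> D) :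
  V n.+1 = 1 ->
  \sum_(p < n) (V p.+1 + t * V p.+2) *: 'X^p =
    t *: \sum_(q < n) (V q.+1 + V q.+2) *: ('X + (1 - t)%:P) ^+ q ->
  'X * (\sum_(m < n) V m.+2 *: der_appell t m) = der_appell t n - (V 1)%:P.
Proof.
move=> Vn; set u := \sum_(m < n) V m.+2 *: 'X^m.
set Y := \sum_(m < n) _ *: der_appell t m.
have LY : der_op t Y = (1 - t) *: u.
  rewrite !linear_sum; apply: eq_bigr => m _ /=.
  by rewrite [in LHS]linearZ /= der_op_appell !scalerA mulrC.
have Eu : \sum_(p < n) V p.+1 *: 'X^p = (V 1)%:P + 'X * u - 'X^n.
  have : \sum_(p < n.+1) V p.+1 *: 'X^p = (V 1)%:P + 'X * u.
    rewrite big_ord_recl expr0 alg_polyC mulr_sumr; congr (_ + _).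
    by apply: eq_bigr => i _; rewrite -scalerAr -exprS.
  by rewrite big_ord_recr /= Vn scale1r => <-; rewrite addrK.
have split_sum c : \sum_(p < n) (V p.+1 + c * V p.+2) *: 'X^p =
    (V 1)%:P + 'X * u - 'X^n + c *: u.
  rewrite -Eu scaler_sumr -big_split; apply: eq_bigr => p _ /=.
  by rewrite scalerDl scalerA.
have -> : \sum_(q < n) (V q.+1 + V q.+2) *: ('X + (1 - t)%:P) ^+ q =
    shift (1 - t) ((V 1)%:P + 'X * u - 'X^n + u).
  rewrite -{2}[u]scale1r -split_sum linear_sum; apply: eq_bigr => q _ /=.
  by rewrite linearZ /= shiftXn mul1r.
rewrite split_sum; set Z := (V 1)%:P + 'X * u - 'X^n.
(* Shifting by t leaves only shifts by t and by 1, the two that occur in [der_op]. *)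
move=> /(congr1 (shift t)); rewrite shiftZ shift_shift.
rewrite [t + (1 - t)]addrC subrK (shiftD t Z) (shiftD 1 Z) shiftZ => FE.
have Q0 : (1 - t) *: Z + t *: (shift t Y - shift 1 Y) = 0.
  apply: (der_op_inj t1); rewrite linear0 der_opD !der_opZ (der_opB t (shift t Y)).
  rewrite !der_op_shift LY !shiftZ -scalerBr scalerA [t * _]mulrC.
  rewrite -scalerA -scalerDr {1}/der_op.
  suff -> : shift t Z - t *: shift 1 Z + t *: (shift t u - shift 1 u) = 0.
    by rewrite scaler0.
  by rewrite scalerBr addrACA FE -opprD -scalerDr subrr.
apply: (der_op_inj t1); rewrite der_opB der_op_appell.
have cC : der_op t (V 1)%:P = (1 - t) *: (V 1)%:P.
  by rewrite /der_op !shiftC scalerBl scale1r.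
have LXY : der_op t ('X * Y) = 'X * der_op t Y + t *: (shift t Y - shift 1 Y).
  rewrite /der_op !shiftM !shiftX -!mul_polyC; ring.
apply/eqP; rewrite -subr_eq0 -Q0 cC LXY LY; apply/eqP.
by rewrite /Z -!mul_polyC polyCB; ring.
Qed.

Definition uniform_hilbert (D : comNzRingType) (t : D) r n :=
  \sum_(j < r) (der t j * geom t (r - j)) *+ 'C(n, j).

(** The substitution j = n - i turns C(n, j) d_j into a coefficient of the Appell polynomial. The
    free bound [b] gives the sums for different n a common range. *)
Lemma uniform_hilbertE (D : comNzRingType) (t : D) k n b : (n < b)%N ->
  uniform_hilbert t (n - k) n =
    \sum_(i < b) (der_appell t n)`_i * geom t (i - k).
Proof.
move=> ltnb; rewrite /uniform_hilbert.
transitivity (\sum_(i < n.+1) (der_appell t n)`_i * geom t (i - k)); last first.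
  rewrite (big_ord_widen b (fun i => (der_appell t n)`_i * geom t (i - k))) //.
  rewrite big_mkcond /=; apply: eq_bigr => i _; case: ltnP => // gt.
  by rewrite coef_der_appell bin_small // mulr0n mul0r.
rewrite [RHS](reindex_inj rev_ord_inj) /=.
rewrite (big_ord_widen n.+1 (fun j => (der t j * geom t (n - k - j)) *+ 'C(n, j)));
  last by lia.
rewrite big_mkcond; apply: eq_bigr => i _ /=; have lti := ltn_ord i.
rewrite coef_der_appell subSS subKn -1?ltnS // bin_sub -1?ltnS //.
have -> : (n - i - k = n - k - i)%N by lia.
case: ltnP => [_|ge]; first by rewrite mulrnAl.
have -> : (n - k - i = 0)%N by lia.
by rewrite /geom big_ord0 mulr0.
Qed.

(** This is the recurrence [derE], whose summand i = n - 1 vanishes. *)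
Lemma uniform_hilbert1 (D : comNzRingType) (t : D) n : (0 < n)%N ->
  t * uniform_hilbert t n.-1 n = der t n.
Proof.
case: n => // n _; rewrite derE // big_ord_recr /= subSnn /geom big_ord0.
rewrite !mulr0 mul0rn addr0 mulr_sumr; apply: eq_bigr => i _.
by rewrite mulrnAr mulrCA subSn //; have := ltn_ord i; lia.
Qed.

(** The constant coefficient of [shift_equation_solution] gives the first claim. Its coefficients of
    X^(i+1), multiplied by [geom t (i - k)] and summed over i, give the second. *)
Lemma uniform_hilbert_rec (D : idomainType) (t : D) (t1 : t != 1)
    (n : nat) (V : nat -> D) :
  V n.+1 = 1 ->
  \sum_(p < n) (V p.+1 + t * V p.+2) *: 'X^p =
    t *: \sum_(q < n) (V q.+1 + V q.+2) *: ('X + (1 - t)%:P) ^+ q ->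
  V 1%N = der t n /\ forall k,
  \sum_(m < n) V m.+2 * uniform_hilbert t (m - k) m =
    uniform_hilbert t (n - k.+1) n.
Proof.
move=> Vn /(shift_equation_solution t1 Vn) E.
have coefE i : \sum_(m < n) V m.+2 * (der_appell t m)`_i = (der_appell t n)`_i.+1.
  have := congr1 (fun p : {poly D} => p`_i.+1) E.
  rewrite coefXM /= coefB coefC /= subr0 coef_sum => <-.
  by apply: eq_bigr => m _; rewrite coefZ.
split=> [|k].
  have /eqP := congr1 (fun p : {poly D} => p`_0) E.
  rewrite coefXM /= coefB coefC /= coef_der_appell bin0 subn0 eq_sym subr_eq0.
  by move/eqP.
rewrite (uniform_hilbertE t k.+1 (leqnSn n.+1)) big_ord_recl sub0n.
rewrite {1}/geom big_ord0 mulr0 add0r.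
transitivity (\sum_(m < n) \sum_(i < n.+1)
    V m.+2 * (der_appell t m)`_i * geom t (i - k)).
  apply: eq_bigr => m _; rewrite (uniform_hilbertE t k (leqW (ltn_ord m))).
  by rewrite mulr_sumr; apply: eq_bigr => i _; rewrite mulrA.
rewrite exchange_big; apply: eq_bigr => i _.
by rewrite -mulr_suml coefE lift0 subSS.
Qed.

(** * Inversion sequences *)

(* The sequences (e_p, ..., e_(p + l - 1)) with [e_i < i]. *)
Fixpoint inv_words p l : seq (seq nat) :=
  if l is l'.+1 then [seq v :: s | v <- iota 0 p, s <- inv_words p.+1 l']
  else [:: [::]].

Definition no_zero_pair (s : seq nat) :=
  sorted (fun x y => ~~ ((x == 0%N) && (y == 0%N))) s.

Definition good (s : seq nat) := (last 0%N s != 0%N) && no_zero_pair s.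

Definition ascents x (s : seq nat) := sumn (pairmap (fun x y => (x < y)%N : nat) x s).

Lemma sum_inv_words_cons (V : nmodType) p l (F : seq nat -> V) :
  \sum_(s <- inv_words p l.+1) F s =
    \sum_(v < p) \sum_(s <- inv_words p.+1 l) F ((v : nat) :: s).
Proof.
rewrite /= big_allpairs_dep /= -(big_mkord predT (fun v =>
  \sum_(s <- inv_words p.+1 l) F (v :: s))) /index_iota subn0.
by apply: eq_bigr.
Qed.

(** * Weights of the tails of inversion sequences *)

Section Completions.
Variables (D : comNzRingType) (t : D).

(* [v] is the p-th entry; the sum is over the l entries after it. *)
Definition completions p l v : D :=
  \sum_(s <- inv_words p.+1 l | good (v :: s)) t ^+ ascents v s.

Lemma completions0 p v : completions p 0 v = (v != 0%N)%:R.
Proof. by rewrite /completions big_mkcond big_seq1 /good /= andbT; case: eqP. Qed.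

Lemma completionsS p l v :
  completions p l.+1 v = \sum_(u < p.+1)
    (if (v == 0%N) && (u == 0 :> nat) then 0 else t ^+ (v < u)%N) *
      completions p.+1 l u.
Proof.
rewrite /completions big_mkcond sum_inv_words_cons; apply: eq_bigr => u _.
rewrite mulr_sumr [RHS]big_mkcond /=; apply: eq_bigr => s _.
rewrite /good /no_zero_pair /=; case: (_ && (u == 0%N :> nat)) => /=.
  by rewrite andbF mul0r; case: ifP.
by case: ifP => // _; rewrite ?mulr0 // exprD.
Qed.

(** Compare the possible next entries u. Since v + 1 < u and v < u differ only at u = v + 1, the
    only changes are the factor t lost there and, for v = 0, the choice u = 0, forbidden after 0 but
    allowed after 1. *)
Lemma completions_succ p l v : (v < p)%N ->
  completions p l.+1 v.+1 = completions p l.+1 v +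
    (1 - t) * completions p.+1 l v.+1 +
    (if v == 0%N then completions p.+1 l 0 else 0).
Proof.
move=> ltvp; have ltv : (v.+1 < p.+1)%N by [].
rewrite !completionsS (bigD1 (Ordinal ltv)) //=.
rewrite [in RHS](bigD1 (Ordinal ltv)) //= ltnn ltnSn andbF expr1 expr0.
have z0 : (ord0 : 'I_p.+1) != Ordinal ltv by [].
rewrite (bigD1 ord0) //= [in RHS](bigD1 ord0) //= andbT expr0.
set S := \sum_(i < _ | _) _; set S' := \sum_(i < _ | _) _.
have -> : S' = S.
  apply: eq_bigr => u /andP[]; rewrite -!val_eqE /= => uv u0.
  rewrite (negPf u0) andbF; congr (_ ^+ _ * _).
  by have -> : (v.+1 < u)%N = (v < u)%N by lia.
by case: eqP => _; ring.
Qed.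

(* V_p + V_(p+1) in terms of V_p = [completions p l 0], where p + l = n and
   V_(n+1) = 1 by convention. *)
Definition completion_pair p l :=
  completions p l 0 + (if l is l'.+1 then completions p.+1 l' 0 else 1).

(** Iterates [completions_succ] down to v = 0; Pascal's rule collects the coefficients. *)
Lemma completionsE p l v : (v < p)%N ->
  completions p l v.+1 = \sum_(a < l.+1)
    ((1 - t) ^+ a * completion_pair (p + a) (l - a)) *+ 'C(v + a, a).
Proof.
elim: l p v => [|l IH] p v.
  by move=> _; rewrite big_ord1 completions0 /completion_pair completions0 /=
    addn0 bin0 expr0 mul1r add0r.
elim: v => [|v IHv] ltvp.
  rewrite completions_succ // IH // mulr_sumr [in RHS]big_ord_recl /= expr0 mul1r.
  rewrite /completion_pair addn0 bin0 mulr1n addrAC; congr (_ + _).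
  apply: eq_bigr => a _; rewrite !add0n !binn !mulr1n exprS mulrA.
  by rewrite addSnnS subSS.
rewrite completions_succ //= addr0 IHv 1?ltnW // IH; last exact: leqW.
rewrite mulr_sumr [in LHS]big_ord_recl [in RHS]big_ord_recl /= !bin0 -addrA.
congr (_ + _); rewrite -big_split; apply: eq_bigr => a _ /=.
rewrite /bump leq0n add1n subSS [(v.+1 + a.+1)%N]addSn binS mulrnDr.
by rewrite [(v.+1 + a)%N]addSnnS [(p.+1 + a)%N]addSnnS mulrnAr mulrA -exprS.
Qed.

Lemma sum_bin_diag p a : (\sum_(v < p) 'C(v + a, a) = 'C(p + a, a.+1))%N.
Proof.
elim: p => [|p IH]; first by rewrite big_ord0 bin_small.
by rewrite big_ord_recr /= IH addSn binS.
Qed.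

(** The entry after a zero is some v + 1 with v < p and makes an ascent; [completionsE] is then
    summed over v by the hockey-stick identity. *)
Lemma completions0S p l :
  completions p l.+1 0 = t * \sum_(a < l.+1)
    ((1 - t) ^+ a * completion_pair (p.+1 + a) (l - a)) *+ 'C(p + a, a.+1).
Proof.
rewrite completionsS big_ord_recl /= mul0r add0r mulr_sumr.
transitivity (t * \sum_(v < p) completions p.+1 l v.+1).
  by rewrite mulr_sumr; apply: eq_bigr => i _; rewrite expr1.
rewrite -mulr_sumr; congr (_ * _).
rewrite (eq_bigr _ (fun v _ => completionsE _ _)); last first.
  by move=> *; apply: leqW.
rewrite exchange_big; apply: eq_bigr => a _.
by rewrite -sum_bin_diag; exact: sumrMnr.
Qed.

(* The V_p of the header, for sequences of length n. *)
Definition tail_weight n p :=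
  if (p <= n)%N then completions p (n - p) 0 else 1.

Lemma tail_weight_last n : tail_weight n n.+1 = 1.
Proof. by rewrite /tail_weight ltnn. Qed.

(** At X^k the term q = k on the right gives t (V_(k+1) + V_(k+2)), and the terms q > k add up to (1
    - t) V_(k+1) by [completions0S]. *)
Lemma tail_weight_equation n (V := tail_weight n) :
  \sum_(p < n) (V p.+1 + t * V p.+2) *: 'X^p =
    t *: \sum_(q < n) (V q.+1 + V q.+2) *: ('X + (1 - t)%:P) ^+ q.
Proof.
have pairE p : (p < n)%N -> V p.+1 + V p.+2 = completion_pair p.+1 (n - p.+1).
  move=> ltp; rewrite /V /tail_weight /completion_pair ltp.
  case: ltnP => [lt|ge]; last by have -> : (n - p.+1 = 0)%N by lia.
  by have -> : (n - p.+1 = (n - p.+2).+1)%N by lia.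
apply/polyP => k; rewrite -(poly_def n (fun p => V p.+1 + t * V p.+2)).
rewrite coef_poly coefZ coef_sum.
under eq_bigr do rewrite coefZ coef_XaddCn.
case: ltnP => [ltk|lek]; last first.
  rewrite big1 ?mulr0 // => i _; rewrite bin_small ?mulr0n ?mulr0 //.
  exact: leq_trans (ltn_ord i) lek.
pose F q := (V q.+1 + V q.+2) * ((1 - t) ^+ (q - k) *+ 'C(q, k)).
rewrite -(big_mkord predT F) (big_cat_nat (n := k)) //=; last exact: ltnW.
rewrite big_nat big1 ?add0r => [|i /andP[_ ?]]; last first.
  by rewrite /F bin_small ?mulr0n ?mulr0.
rewrite big_ltn // {1}/F subnn binn expr0 mulr1 mulrDr.
suff -> : t * \sum_(k.+1 <= q < n) F q = (1 - t) * V k.+1 by ring.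
have Vk : V k.+1 = completions k.+1 (n - k.+1) 0 by rewrite /V /tail_weight ltk.
rewrite Vk -[k.+1 in LHS]add0n big_addn; case E : (n - k.+1)%N => [|l].
  (* For k = n - 1 there is no q > k, and V_n = 0 because the last entry must not be 0. *)
  by rewrite completions0 big_geq // !mulr0.
rewrite completions0S mulrCA; congr (_ * _); rewrite mulr_sumr big_mkord.
apply: eq_bigr => a _; have lta := ltn_ord a.
rewrite /F pairE; last by lia.
have -> : ((a + k.+1).+1 = k.+2 + a)%N by lia.
have -> : (n - (k.+2 + a) = l - a)%N by lia.
have -> : (a + k.+1 - k = a.+1)%N by lia.
have -> : 'C(a + k.+1, k) = 'C(k.+1 + a, a.+1).
  rewrite addnC -(@bin_sub _ k); last by lia.
  by congr 'C(_, _); lia.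
by rewrite mulrnAr [RHS]mulrnAr mulrA -exprS mulrC.
Qed.

End Completions.

(** * Decomposition of D_n^k at the first later zero *)

Lemma asc_cons x s : asc (x :: s) = ascents x s.
Proof.
rewrite /asc -sum1_card; under eq_bigl do rewrite inE.
rewrite big_mkcond /=; elim: s x => [|y s IH] x; first by rewrite big_ord0.
rewrite big_ord_recl /= /ascents /= -[sumn _]/(ascents y s) -IH.
by congr (_ + _)%N.
Qed.

Lemma mem_inv_words p l s : (s \in inv_words p l) =
  (size s == l) && [forall i : 'I_(size s), nth 0 s i < p + i]%N.
Proof.
elim: l p s => [|l IH] p [|x s] //=.
- by rewrite inE /=; symmetry; apply/forallP => -[].
- by apply/allpairsPdep => -[? [? [? ?]]].
have -> : (x :: s \in inv_words p l.+1) = (x < p)%N && (s \in inv_words p.+1 l).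
  apply/allpairsPdep/andP => [[y [r [yp rl [-> ->]]]]|[xp sl]].
    by move: yp; rewrite mem_iota.
  by exists x, s; rewrite mem_iota.
rewrite IH andbCA eqSS; congr (_ && _).
apply/andP/forallP => [[xp /forallP H] [[|i] lti]|H].
- by rewrite addn0.
- by have := H (Ordinal (lti : (i < size s)%N)); rewrite addSnnS.
split; first by have := H ord0; rewrite addn0.
by apply/forallP => i; have := H (lift ord0 i); rewrite /= /bump add1n addSnnS.
Qed.

Lemma inv_words_uniq p l : uniq (inv_words p l).
Proof.
elim: l p => // l IH p; apply: allpairs_uniq; rewrite ?iota_uniq //.
by move=> [x s] [y r] _ _ [-> ->].
Qed.

Lemma is_invseqE n s : (s \in inv_words 1 n) = (size s == n) && is_invseq s.
Proof.
by rewrite mem_inv_words; congr (_ && _); apply: eq_forallb.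
Qed.

Lemma in_D_good s : in_D s = is_invseq s && good s.
Proof.
rewrite /in_D /good; congr [&& _, _ & _].
rewrite /no_zero_pair; case: s => [|x s] /=; first by apply/forallP => -[].
apply/forallP/(pathP 0%N) => [H i lti | H i]; last exact: H.
exact: (H (Ordinal lti)).
Qed.

Lemma sum_Dk (V : nmodType) n k (F : seq nat -> V) :
  \sum_(e in Dk n.+1 k) F [seq val x | x <- e] =
    \sum_(s <- inv_words 1 n.+1 | in_Dk k s) F s.
Proof.
rewrite -[RHS]big_filter -big_enum -(big_map (fun e : n.+1.-tuple 'I_n.+1 =>
  [seq val x | x <- e]) predT F).
apply: perm_big; apply: uniq_perm.
- rewrite map_inj_uniq ?enum_uniq // => e e' /(inj_map val_inj) ?.
  exact: val_inj.
- by apply: filter_uniq; apply: inv_words_uniq.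
move=> s; rewrite mem_filter; apply/mapP/andP => [[e eD ->]|[sk]].
  move: eD; rewrite mem_enum inE => eD; split=> //.
  rewrite is_invseqE size_map size_tuple eqxx /=.
  by move: eD; case: k => // -[|k] /=; [case/andP | case/and3P => _ /andP[]].
rewrite mem_inv_words => /andP[/eqP sz /forallP lts].
have szi : size [seq inord x : 'I_n.+1 | x <- s] == n.+1 by rewrite size_map sz.
have sE : s = [seq val x | x <- Tuple szi].
  rewrite -map_comp map_id_in // => x /(nthP 0%N)[i lti <-] /=.
  by rewrite inordK //; have /= := lts (Ordinal lti); lia.
by exists (Tuple szi) => //; rewrite mem_enum inE -sE.
Qed.

(* Here [map succn r] is the maximal positive initial run. *)
Lemma sum_inv_words_run (V : nmodType) p l (F : seq nat -> V) :
  \sum_(s <- inv_words p.+1 l) F s =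
    \sum_(r <- inv_words p l) F (map succn r) +
    \sum_(m < l) \sum_(r <- inv_words p m)
       \sum_(s <- inv_words (p + m).+2 (l - m.+1)) F (map succn r ++ 0%N :: s).
Proof.
elim: l p F => [|l IH] p F; first by rewrite big_ord0 addr0 /= !big_seq1.
rewrite !sum_inv_words_cons big_ord_recl [in X in _ = _ + X]big_ord_recl.
rewrite /= big_seq1 /= addn0 subSS subn0 addrCA; congr (_ + _).
under eq_bigr do rewrite /bump leq0n add1n IH.
rewrite big_split /=; congr (_ + _); rewrite exchange_big /=.
apply: eq_bigr => m _.
rewrite /bump leq0n add1n sum_inv_words_cons; apply: eq_bigr => u _.
apply: eq_bigr => r _.
by rewrite addSnnS subSS.
Qed.

Lemma in_Dk_size k s : in_Dk k s -> (k <= size s)%N.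
Proof.
case: k => // -[|k] /=; last by case/andP.
by case: s => // /and3P[_ /eqP].
Qed.

Lemma fp_run r : fp (0%N :: map succn r) = r.
Proof.
have nz : ~~ has (pred1 0%N) (map succn r) by apply/hasPn => _ /mapP[x _ ->].
rewrite /fp /fz /= (hasNfind nz) subn2 /= take_size -map_comp map_id_in //.
Qed.

Lemma fp_run_zero r s : fp (0%N :: map succn r ++ 0%N :: s) = r.
Proof.
have nz : ~~ has (pred1 0%N) (map succn r) by apply/hasPn => _ /mapP[x _ ->].
rewrite /fp /fz /= find_cat (negPf nz) /= addn0 subn2 /= take_size_cat //.
by rewrite -map_comp map_id_in.
Qed.

Lemma path_succ x r :
  path (fun x y => ~~ ((x == 0%N) && (y == 0%N))) x (map succn r).
Proof. by elim: r x => //= y r IH x; rewrite andbF IH. Qed.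

Lemma good_run x r : good (0%N :: map succn (x :: r)).
Proof. by rewrite /good /no_zero_pair /= last_map path_succ. Qed.

Lemma good_run_zero x r s :
  good (0%N :: map succn (x :: r) ++ 0%N :: s) = good (0%N :: s).
Proof.
by rewrite /good /no_zero_pair /= last_cat cat_path /= path_succ last_map.
Qed.

Lemma ascents_succ x r : ascents x.+1 (map succn r) = ascents x r.
Proof. by rewrite /ascents; elim: r x => //= y r IH x; rewrite IH ltnS. Qed.

Lemma asc_run x r : asc (0%N :: map succn (x :: r)) = (asc (x :: r)).+1.
Proof. by rewrite !asc_cons -[ascents x r]ascents_succ /ascents /= add1n. Qed.

Lemma asc_run_zero x r s :
  asc (0%N :: map succn (x :: r) ++ 0%N :: s) =
    ((asc (x :: r)).+1 + ascents 0 s)%N.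
Proof.
by rewrite !asc_cons -[ascents x r]ascents_succ /ascents /= pairmap_cat sumn_cat last_map.
Qed.

Lemma in_Dk_nil k : in_Dk k [::] = false.
Proof. by case: k => [|[|k]] //=; rewrite /in_D andbF. Qed.

Lemma in_Dk_words1 n : {in inv_words 1 n, in_Dk 1 =1 good}.
Proof. by move=> s; rewrite is_invseqE /= in_D_good => /andP[_ ->]. Qed.

Lemma in_Dk_words2 k n : {in inv_words 1 n,
  in_Dk k.+2 =1 (fun s => good s && in_Dk k.+1 (fp s))}.
Proof.
move=> s /in_Dk_words1 /= ->; rewrite andb_idl // => /andP[].
case: s => // x s _ /(@in_Dk_size k.+1) /leq_trans; apply.
by rewrite size_map size_take_min geq_minr.
Qed.

Lemma eq_big_seq_cond (V : nmodType) (I : eqType) (r : seq I) (P Q : pred I)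
    (F : I -> V) :
  {in r, P =1 Q} -> \sum_(i <- r | P i) F i = \sum_(i <- r | Q i) F i.
Proof.
move=> PQ; rewrite big_seq_cond [RHS]big_seq_cond.
by apply: eq_bigl => i; apply: andb_id2l => /PQ.
Qed.

Local Arguments in_Dk : simpl never.

Section AscentPolynomials.
Variables (D : idomainType) (t : D).

Definition asc_gf k n : D := \sum_(s <- inv_words 1 n | in_Dk k s) t ^+ asc s.

Lemma asc_gf1 n : asc_gf 1 n.+1 = tail_weight t n.+1 1.
Proof.
rewrite /asc_gf (eq_big_seq_cond _ (@in_Dk_words1 n.+1)).
rewrite big_mkcond sum_inv_words_cons big_ord1 /= -big_mkcond /=.
rewrite /tail_weight subSS subn0 /completions.
by apply: eq_bigr => s _; rewrite asc_cons.
Qed.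

(** Here m is the length of r = [fp e]. Entering the run [map succn r] from the leading 0 is an
    ascent, which gives t; inside the run the ascents are those of r, and the drop to the next zero
    gives none. *)
Lemma asc_gf_rec k n : asc_gf k.+2 n.+1 =
  t * \sum_(m < n.+1) tail_weight t n.+1 m.+2 * asc_gf k.+1 m.
Proof.
have nil_gf m : \sum_(r <- inv_words 1 m | in_Dk k.+1 r) t ^+ (asc r).+1 =
    t * asc_gf k.+1 m.
  by rewrite /asc_gf mulr_sumr; apply: eq_bigr => r _; rewrite exprS.
rewrite {1}/asc_gf.
rewrite (eq_big_seq_cond _ (@in_Dk_words2 k n.+1)).
rewrite big_mkcond sum_inv_words_cons big_ord1 /= sum_inv_words_run.
(* The last summand, m = n, is the case in which no zero follows the run. *)
rewrite big_ord_recr mulrDr addrC /=; congr (_ + _); last first.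
  rewrite tail_weight_last mul1r -nil_gf [RHS]big_mkcond /=.
  apply: eq_bigr => -[|x r] _; first by rewrite in_Dk_nil andbF.
  by rewrite good_run fp_run asc_run.
rewrite mulr_sumr; apply: eq_bigr => m _; have ltm := ltn_ord m.
rewrite mulrCA -nil_gf mulr_sumr [RHS]big_mkcond /=.
apply: eq_bigr => r _; case: (boolP (in_Dk _ r)) => [|nD]; last first.
  by rewrite big1 // => s _; rewrite fp_run_zero (negPf nD) andbF.
case: r => [|x r] rD; first by rewrite in_Dk_nil in rD.
rewrite /tail_weight ifT; last by lia.
rewrite subSS /completions mulr_suml [RHS]big_mkcond /=.
apply: eq_bigr => s _; rewrite good_run_zero (fp_run_zero (x :: r)) rD andbT.
by case: ifP => // _; rewrite asc_run_zero exprD mulrC.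
Qed.

Lemma asc_gf0 k : asc_gf k.+1 0 = 0.
Proof.
apply: big1_seq => s /andP[sD]; rewrite mem_seq1 => /eqP sE.
by rewrite sE in_Dk_nil in sD.
Qed.

(** Both sides satisfy the same recursion in k, whose weights do not depend on k; the base case is
    V_1 = d_n. *)
Lemma asc_gfE k n : t != 1 -> asc_gf k.+1 n = t ^+ k.+1 * uniform_hilbert t (n - k.+1) n.
Proof.
move=> t1; elim: k n => [|k IH] [|n].
- by rewrite asc_gf0 /uniform_hilbert big_ord0 mulr0.
- have [V1 _] := uniform_hilbert_rec t1 (tail_weight_last t n.+1)
    (tail_weight_equation t n.+1).
  by rewrite asc_gf1 V1 expr1 subn1 uniform_hilbert1.
- by rewrite asc_gf0 /uniform_hilbert big_ord0 mulr0.
have [_ <-] := uniform_hilbert_rec t1 (tail_weight_last t n.+1)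
  (tail_weight_equation t n.+1).
rewrite asc_gf_rec exprS -mulrA; congr (_ * _); rewrite mulr_sumr.
by apply: eq_bigr => m _; rewrite IH mulrCA.
Qed.

End AscentPolynomials.

(** * The dragon marriage condition *)

Section Admissible.
Local Open Scope nat_scope.
Variables (T : finType) (rk : {set T} -> nat) (C : {set {set T}}).
Variable (al : {set T} -> nat).
Implicit Types (A B F G Z : {set T}) (N : {set T} -> nat).

Hypothesis rk_submod : forall A B, rk (A :|: B) + rk (A :&: B) <= rk A + rk B.
Hypothesis C_chain : forall F G, F \in C -> G \in C -> (F \subset G) || (G \subset F).
Hypotheses (C0 : set0 \in C) (CT : setT \in C).

(** No member of the chain lies strictly between G and F. The order of the two is fixed by further
    conditions, such as [G \proper Z] and [Z \subset F]. *)
Definition consecutive G F :=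
  [/\ G \in C, F \in C & forall K, K \in C -> (K \subset G) || (F \subset K)].

Definition admissible_at Z v := (Z \in C -> v = al Z) /\
  forall G F, consecutive G F -> G \proper Z -> Z \subset F ->
    v + rk G < al G + rk Z.

(* With N Z the degree of a monomial in the h_A with A inside Z, these are the
   conditions under which the degree map of the product of the minors F / G,
   over consecutive G and F in C, does not vanish on that monomial: the
   dragon marriage condition of Postnikov. *)
Definition admissible N := forall Z, admissible_at Z (N Z).

(** F is the smallest member of C containing A, and G the largest one not containing A. *)
Lemma consecutive_around A : A != set0 -> exists G F,
  [/\ consecutive G F, ~~ (A \subset G) & A \subset F].
Proof.
move=> A0; pose P F := (F \in C) && (A \subset F).
pose Q G := (G \in C) && ~~ (A \subset G).
have PT : P setT by rewrite /P CT subsetT.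
have Q0 : Q set0 by rewrite /Q C0 subset0.
case: (arg_minnP (fun F : {set T} => #|F|) PT) => F /andP[FC AF] Fmin.
case: (arg_maxnP (fun G : {set T} => #|G|) Q0) => G /andP[GC AG] Gmax.
exists G, F; split=> //; split=> // K KC; case: (boolP (A \subset K)) => AK.
  apply/orP; right; case/orP: (C_chain KC FC) => // KF.
  by have /eqP-> : K == F by rewrite eqEcard KF Fmin // /P KC.
apply/orP; left; case/orP: (C_chain GC KC) => // GK.
by have /eqP-> : G == K by rewrite eqEcard GK; apply: Gmax; rewrite /Q KC.
Qed.

(** Take Z = G :|: A for the members G and F of C around A. The condition at G gives N G = al G, so
    the one at Z asks for N Z + 1 - N G < rk Z - rk G, whose right-hand side is at most rk A by
    submodularity. *)
Lemma admissible_rank1 A N : A != set0 -> rk A <= 1 ->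
  (forall Z Z', Z \subset Z' -> N Z <= N Z') ->
  ~ admissible (fun Z => N Z + (A \subset Z)).
Proof.
move=> A0 A1 Nmono adm.
have [G [F [GF AG AF]]] := consecutive_around A0; have [GC FC cons] := GF.
have GprF : G \subset F.
  case/orP: (C_chain GC FC) => // FG.
  by rewrite (subset_trans AF FG) in AG.
have GZ : G \proper G :|: A.
  rewrite properEneq subsetUl andbT; apply: contraNneq AG => ->.
  exact: subsetUr.
have [_ /(_ G F GF GZ)] := adm (G :|: A); rewrite subUset GprF AF => /(_ isT).
have [/(_ GC) + _] := adm G; rewrite (negPf AG) subsetUr.
move: (Nmono _ _ (subsetUl G A)) (rk_submod G A) A1; clear; lia.
Qed.

(** A witness Z is a set at which the conditions for N Z and N Z + 1 can differ: either its value is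
    prescribed, or its inequality is tight. *)
Definition separated N A B := exists Z, [/\ A \subset Z, ~~ (B \subset Z) &
  Z \in C \/ exists G F, [/\ consecutive G F, G \proper Z, Z \subset F &
    N Z + 1 + rk G = al G + rk Z]].

(** With J = A :|: B, the products h_A h_B, h_A h_J, h_J h_B and h_J h_J have the same degree inside
    each Z containing both or neither of A and B. If Z contains A but not B, the first two
    contribute 1 and the others 0. *)
Definition one_sided N A B (b : nat) := forall Z, A \subset Z ->
  ~~ (B \subset Z) -> admissible_at Z (N Z + b).

Definition two_sided N A B := forall Z, (A \subset Z) = (B \subset Z) ->
  admissible_at Z (N Z + (A \subset Z).*2).

Lemma admissible_split N A B (b1 b2 : nat) :
  admissible (fun Z => N Z + (if A \subset Z then if B \subset Z then 2 else b1
                              else if B \subset Z then b2 else 0)) <->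
  [/\ two_sided N A B, one_sided N A B b1 & one_sided N B A b2].
Proof.
split=> [adm|[two one1 one2]].
  split=> Z; have := adm Z.
  - by move=> + AB; rewrite -AB; case: (A \subset Z).
  - by move=> + AZ /negPf BZ; rewrite AZ BZ.
  by move=> + BZ /negPf AZ; rewrite AZ BZ.
move=> Z; have := (two Z, one1 Z, one2 Z) => -[[]].
case: (A \subset Z) (B \subset Z) => -[] // H1 H2 H3.
- exact: H1.
- exact: H2.
- exact: H3.
- exact: H1.
Qed.

Lemma one_sided_eq N A B : ~ separated N A B ->
  one_sided N A B 1 <-> one_sided N A B 0.
Proof.
move=> nsep; have eqK Z : A \subset Z -> ~~ (B \subset Z) ->
    admissible_at Z (N Z + 1) <-> admissible_at Z (N Z + 0).
  move=> AZ BZ; rewrite addn0.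
  have ZC : Z \notin C by apply/negP => ZC; apply: nsep; exists Z; split; [..|left].
  split=> -[_ H]; split=> [|G F GF GZ ZF]; do ?by rewrite (negPf ZC).
    by move: (H G F GF GZ ZF); clear; lia.
  have := H G F GF GZ ZF; rewrite leq_eqVlt => /orP[/eqP E|]; last by clear; lia.
  exfalso; apply: nsep; exists Z; split=> //; right; exists G, F.
  by split=> //; move: E; clear; lia.
by split=> H Z AZ BZ; apply/(eqK Z AZ BZ); apply: H.
Qed.

(** An uncrossing argument: both witnesses would be tight and lie between the same consecutive G1
    and F1. The strict inequality at their union, with its extra 2, and the weak one at their
    intersection then contradict the two equalities, as N is supermodular and rk submodular. *)
Lemma not_both_separated N A B :
  (forall Z Z', N Z + N Z' <= N (Z :|: Z') + N (Z :&: Z')) ->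
  two_sided N A B -> separated N A B -> ~ separated N B A.
Proof.
move=> Nsuper two.
(* A member of C is comparable with the witness Z, and if it contains X it cannot lie inside Z. *)
have chain_sep X Y : separated N Y X -> forall F, F \in C -> X \subset F -> Y \subset F.
  move=> [Z [YZ XZ ZC]] F FC XF; apply: contraT => YF; exfalso.
  case: ZC => [ZC|[G' [F' [[_ _ cons] /proper_sub GZ ZF _]]]].
    case/orP: (C_chain FC ZC) => [/(subset_trans XF)|/(subset_trans YZ)].
      by rewrite (negPf XZ).
    by rewrite (negPf YF).
  case/orP: (cons F FC) => [FG|FF'].
    by rewrite (subset_trans XF (subset_trans FG GZ)) in XZ.
  by rewrite (subset_trans YZ (subset_trans ZF FF')) in YF.
move=> sA sB; have AB := chain_sep _ _ sB; have BA := chain_sep _ _ sA.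
case: sA => Z1 [AZ1 BZ1 [/AB/(_ AZ1)|]]; first by rewrite (negPf BZ1).
move=> [G1 [F1 [GF1 GZ1 ZF1 tight1]]].
case: sB => Z2 [BZ2 AZ2 [/BA/(_ BZ2)|]]; first by rewrite (negPf AZ2).
move=> [G2 [F2 [GF2 GZ2 ZF2 tight2]]].
have [G1C F1C cons1] := GF1; have [G2C F2C cons2] := GF2.
have AF1 := subset_trans AZ1 ZF1; have BF2 := subset_trans BZ2 ZF2.
have BF1 := AB _ F1C AF1; have AF2 := BA _ F2C BF2.
have nBG1 : ~~ (B \subset G1).
  by apply: contra BZ1 => /subset_trans; apply; apply: proper_sub.
have nAG2 : ~~ (A \subset G2).
  by apply: contra AZ2 => /subset_trans; apply; apply: proper_sub.
have nAG1 : ~~ (A \subset G1) by apply: contra nBG1; apply: AB.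
have nBG2 : ~~ (B \subset G2) by apply: contra nAG2; apply: BA.
have eF : F2 = F1.
  apply/eqP; rewrite eqEsubset; apply/andP; split.
    case/orP: (cons2 _ F1C) => // /(subset_trans AF1); by rewrite (negPf nAG2).
  case/orP: (cons1 _ F2C) => // /(subset_trans AF2); by rewrite (negPf nAG1).
have eG : G2 = G1.
  apply/eqP; rewrite eqEsubset; apply/andP; split.
    case/orP: (cons1 _ G2C) => // /(subset_trans AF1); by rewrite (negPf nAG2).
  case/orP: (cons2 _ G1C) => // /(subset_trans AF2); by rewrite (negPf nAG1).
subst F2 G2.
have [_ /(_ G1 F1 GF1)] : admissible_at (Z1 :|: Z2) (N (Z1 :|: Z2) + 2).
  have := two (Z1 :|: Z2); rewrite (subset_trans AZ1) ?subsetUl //.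
  by rewrite (subset_trans BZ2) ?subsetUr //; apply.
rewrite subUset ZF1 ZF2 => /(_ _ isT).
have -> : G1 \proper Z1 :|: Z2 by apply: proper_sub_trans GZ1 (subsetUl _ _).
move=> /(_ isT) cup.
(* Only weak, since the intersection may be G1 itself. *)
have cap : N (Z1 :&: Z2) + rk G1 <= al G1 + rk (Z1 :&: Z2).
  have [nA nB] : ~~ (A \subset Z1 :&: Z2) /\ ~~ (B \subset Z1 :&: Z2).
    by rewrite !subsetI (negPf AZ2) (negPf BZ1) andbF.
  have := two (Z1 :&: Z2); rewrite (negPf nA) (negPf nB) addn0 => /(_ erefl)[H1 H2].
  have : G1 \subset Z1 :&: Z2 by rewrite subsetI !proper_sub.
  rewrite subEproper => /orP[/eqP E|GZ].
    by move: H1; rewrite -E => /(_ G1C) ->.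
  by apply/ltnW/(H2 G1 F1) => //; apply: subset_trans ZF1; apply: subsetIl.
move: cup cap tight1 tight2 (Nsuper Z1 Z2) (rk_submod Z1 Z2); clear; lia.
Qed.

(* The relation (h_A - h_J) (h_B - h_J) = 0 for J = A u B. *)
Lemma admissible_exchange N A B :
  (forall Z Z', N Z + N Z' <= N (Z :|: Z') + N (Z :&: Z')) ->
  let adm (X Y : {set T}) :=
    `[< admissible (fun Z => N Z + (X \subset Z) + (Y \subset Z)) >] in
  adm A B + adm (A :|: B) (A :|: B) = adm A (A :|: B) + adm (A :|: B) B.
Proof.
move=> Nsuper adm.
have admE (X Y : {set T}) b1 b2 : (forall Z, (X \subset Z) + (Y \subset Z) =
     (if A \subset Z then if B \subset Z then 2 else b1
      else if B \subset Z then b2 else 0)) ->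
    adm X Y = `[< two_sided N A B >] && (`[< one_sided N A B b1 >] &&
              `[< one_sided N B A b2 >]).
  move=> E; apply/asboolP/and3P => [H|[/asboolP H1 /asboolP H2 /asboolP H3]].
    have [] := (admissible_split N A B b1 b2).1 _.
      by move=> Z; have := H Z; rewrite -addnA E.
    by move=> *; split; apply/asboolP.
  move=> Z; rewrite -addnA E.
  exact: ((admissible_split N A B b1 b2).2 (And3 H1 H2 H3)).
rewrite (admE A B 1 1) ?(admE (A :|: B) (A :|: B) 0 0); first last.
- by move=> Z; rewrite ?subUset; case: (A \subset Z) (B \subset Z) => -[].
- by move=> Z; rewrite ?subUset; case: (A \subset Z) (B \subset Z) => -[].
rewrite (admE A (A :|: B) 1 0) ?(admE (A :|: B) B 0 1); first last.
- by move=> Z; rewrite ?subUset; case: (A \subset Z) (B \subset Z) => -[].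
- by move=> Z; rewrite ?subUset; case: (A \subset Z) (B \subset Z) => -[].
case: asboolP => // two /=.
(* One of the two one-sided conditions has the same truth value for both bits, and then the two sums
   have the same terms. *)
case: (pselect (separated N A B)) => [sA|/one_sided_eq sA].
  have /one_sided_eq sB := not_both_separated Nsuper two sA.
  by rewrite (asbool_equiv_eq sB).
by rewrite (asbool_equiv_eq sA) addnC.
Qed.

End Admissible.

(** * Standard monomials *)

Section UniformRank.
Local Open Scope nat_scope.
Variables (n r : nat).
Implicit Types A B Z : {set 'I_n}.

Definition urank A := minn #|A| r.

Lemma urank_submod A B :
  urank (A :|: B) + urank (A :&: B) <= urank A + urank B.
Proof.
rewrite /urank; move: (cardsUI A B) (subset_leq_card (subsetIl A B)).
by move: (subset_leq_card (subsetIr A B)); lia.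
Qed.

Lemma urank_mono A B : A \subset B -> urank A <= urank B.
Proof. by rewrite /urank => /subset_leq_card; lia. Qed.

Lemma urank_proper A B : A \proper B -> #|A| < r -> urank A < urank B.
Proof. by rewrite /urank => /proper_card; lia. Qed.

Lemma urank_gt0 A : 0 < r -> A != set0 -> 0 < urank A.
Proof. by rewrite /urank -card_gt0; lia. Qed.

End UniformRank.

Section StandardMonomials.
Local Open Scope nat_scope.
Variables (n r N : nat) (F : 'I_N -> {set 'I_n}).
Hypotheses (r_gt0 : 0 < r) (r_le_n : r <= n) (F_inj : injective F).
Hypothesis F_flat : forall A,
  (exists i, F i = A) <-> (A != set0) && ((A == setT) || (#|A| < r)).
Local Notation rk := (urank r).
Implicit Types (A B G Z : {set 'I_n}) (m : 'X_{1..N}).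

Lemma F_neq0 i : F i != set0.
Proof. by have [/(_ (ex_intro _ i erefl)) /andP[]] := F_flat (F i). Qed.

Lemma F_small i : F i != setT -> #|F i| < r.
Proof.
have [/(_ (ex_intro _ i erefl)) /andP[_ /orP[/eqP->|//]] _] := F_flat (F i).
by rewrite eqxx.
Qed.

Lemma setT_neq0 : [set: 'I_n] != set0.
Proof. by rewrite -card_gt0 cardsT card_ord (leq_trans r_gt0). Qed.

(** F k is the closure of A, so [upper_sum] takes the same value at A and at F k. *)
Lemma closure_index A : A != set0 ->
  exists k, (forall l, (A \subset F l) = (F k \subset F l)) /\
    (F k = A \/ F k = setT /\ r <= #|A|).
Proof.
move=> A0; case: (ltnP #|A| r) => Ar.
  have [_ []] := F_flat A; first by rewrite A0 Ar orbT.
  by move=> k <-; exists k; split; [|left].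
have [_ []] := F_flat setT; first by rewrite setT_neq0 eqxx.
move=> k Fk; exists k; split; [move=> l|by right; rewrite Fk].
rewrite Fk; apply/idP/idP => [AF|/(subset_trans (subsetT A)) //].
case: (eqVneq (F l) setT) => [-> //|/F_small]; have := subset_leq_card AF; lia.
Qed.

Lemma cap_small k l : ~~ (F k \subset F l) -> #|F k :&: F l| < r.
Proof.
move=> kl; apply: leq_ltn_trans (subset_leq_card (subsetIr _ _)) _.
by apply: F_small; apply: contraNneq kl => ->; apply: subsetT.
Qed.

(** Straightening increases this quantity, and it orders the monomials so that the pairing matrix is
    triangular. *)
Definition weight m := \sum_i m i * #|F i|.

Definition deg_in m Z := \sum_(i | F i \subset Z) m i.

(* The exponents of a monomial in the h_A = sum_(F >= A) x_F whose support is
   a chain, with the bounds of the Feichtner-Yuzvinsky basis; bounding each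
   exponent against all smaller members of the chain is the same as bounding
   it against the preceding one. *)
Definition std m := [forall i, (0 < m i) ==> ((m i < rk (F i)) &&
  [forall j, (0 < m j) ==> ((F j \subset F i) || (F i \subset F j)) &&
    ((F j \proper F i) ==> (m i + rk (F j) < rk (F i)))])].

Lemma stdP m : reflect (forall i, 0 < m i -> m i < rk (F i) /\
    forall j, 0 < m j -> ((F j \subset F i) || (F i \subset F j)) /\
      (F j \proper F i -> m i + rk (F j) < rk (F i)))
  (std m).
Proof.
apply: (iffP forallP) => [H i mi|H i].
  have /implyP/(_ mi)/andP[-> /forallP Hj] := H i; split=> // j mj.
  by have /implyP/(_ mj)/andP[-> /implyP] := Hj j.
apply/implyP => /H[-> Hj]; apply/forallP => j; apply/implyP => /Hj[-> ?].
exact/implyP.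
Qed.

Lemma std_chain m i j : std m -> 0 < m i -> 0 < m j ->
  (F i \subset F j) || (F j \subset F i).
Proof. by move=> /stdP H /H[_ Hj] /Hj[]; rewrite orbC. Qed.

Definition support_chain m : {set {set 'I_n}} :=
  set0 |: (setT |: [set F i | i in [pred i | 0 < m i]]).

Lemma support_chainP m A : reflect
  [\/ A = set0, A = setT | exists2 i, 0 < m i & A = F i]
  (A \in support_chain m).
Proof.
rewrite !inE; apply: (iffP idP).
  case/or3P => [/eqP->|/eqP->|/imsetP[i mi ->]]; [exact: Or31|exact: Or32|].
  by apply: Or33; exists i.
case=> [->|->|[i mi ->]]; rewrite ?eqxx ?orbT //.
by rewrite imset_f ?orbT.
Qed.

Lemma support_chain_total m A B : std m -> A \in support_chain m ->
  B \in support_chain m -> (A \subset B) || (B \subset A).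
Proof.
move=> sm /support_chainP[->|->|[i mi ->]]; rewrite ?sub0set ?subsetT ?orbT //.
case/support_chainP=> [->|->|[j mj ->]]; rewrite ?sub0set ?subsetT ?orbT //.
exact: (std_chain sm).
Qed.

Lemma support_chain_small m A : A \in support_chain m -> A != setT -> #|A| < r.
Proof.
case/support_chainP=> [->|->|[i _ ->]]; rewrite ?cards0 ?eqxx //.
exact: F_small.
Qed.

Lemma deg_inT m : deg_in m setT = mdeg m.
Proof. by rewrite mdegE; apply: eq_bigl => i; rewrite subsetT. Qed.

Lemma deg_in_mono m Z Z' : Z \subset Z' -> deg_in m Z <= deg_in m Z'.
Proof.
move=> ZZ'; rewrite /deg_in big_mkcond [X in _ <= X]big_mkcond.
apply: leq_sum => i _; case: ifP => // /subset_trans/(_ ZZ') -> //.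
Qed.

Lemma deg_in_super m Z Z' :
  deg_in m Z + deg_in m Z' <= deg_in m (Z :|: Z') + deg_in m (Z :&: Z').
Proof.
rewrite /deg_in !(big_mkcond (fun i => _ \subset _)) -!big_split /=.
apply: leq_sum => i _; rewrite subsetI.
case: (boolP (F i \subset Z)) => iZ; case: (boolP (F i \subset Z')) => iZ' /=.
- by rewrite (subset_trans iZ) ?subsetUl.
- by rewrite (subset_trans iZ) ?subsetUl.
- by rewrite (subset_trans iZ') ?subsetUr ?addn0.
by [].
Qed.

Lemma deg_inD m m' Z : deg_in (m + m')%MM Z = deg_in m Z + deg_in m' Z.
Proof. by rewrite -big_split; apply: eq_bigr => i _; rewrite mnmDE. Qed.

Lemma deg_inU k Z : deg_in U_(k)%MM Z = (F k \subset Z).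
Proof.
rewrite /deg_in big_mkcond (bigD1 k) //= mnm1E eqxx big1 ?addn0.
  by case: ifP.
by move=> i; rewrite mnm1E eq_sym => /negPf->; case: ifP.
Qed.

Definition nondegenerate m0 :=
  admissible rk (support_chain m0) (deg_in m0).

(* Non-flats contain at least r elements and have the same rank as the whole
   ground set. *)
Lemma nondegenerate_flats m0 N1 N2 :
  (forall Z, (Z == setT) || (#|Z| < r) -> N1 Z = N2 Z) ->
  (forall Z, N2 Z <= N2 setT) ->
  nondegenerate m0 N1 -> nondegenerate m0 N2.
Proof.
move=> N12 N2mono adm Z; case: (boolP ((Z == setT) || (#|Z| < r))) => [Zf|].
  by rewrite -N12 //; apply: adm.
rewrite negb_or -leqNgt => /andP[ZT Zr]; split=> [ZC|G H GH GZ ZH].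
  by have := support_chain_small ZC ZT; lia.
have HT : H = setT.
  apply: contraTeq (subset_leq_card ZH) => HT; rewrite -ltnNge.
  by case: GH => _ HC _; have := support_chain_small HC HT; lia.
have [_ /(_ G H GH)] := adm setT; rewrite HT subsetT => /(_ _ isT).
have -> : G \proper setT by apply: proper_sub_trans GZ (subsetT _).
move=> /(_ isT); rewrite N12 ?eqxx //.
have -> : rk [set: 'I_n] = rk Z by rewrite /urank cardsT card_ord; lia.
by apply: leq_ltn_trans; rewrite leq_add2r.
Qed.

(** The diagonal of the pairing matrix. Strictly below H the degree is still that of G, and the rank
    grows; at H the degree grows by the exponent of H, which [std] bounds. *)
Lemma std_nondegenerate m : std m -> nondegenerate m (deg_in m).
Proof.
move=> sm Z; split=> // G H [GC HC cons] GZ ZH.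
have GH := proper_sub_trans GZ ZH.
have Gr : #|G| < r.
  apply: (support_chain_small GC); apply: contraTneq GH => ->.
  by rewrite properE subsetT andbF.
case: (eqVneq Z H) => [-> | neqZH]; last first.
  suff -> : deg_in m Z = deg_in m G by rewrite ltn_add2l urank_proper.
  rewrite /deg_in big_mkcond [RHS]big_mkcond; apply: eq_bigr => i _.
  case: (posnP (m i)) => [-> | mi]; first by rewrite !if_same.
  have iC : F i \in support_chain m by apply/support_chainP/Or33; exists i.
  case/orP: (cons _ iC) => [iG|Hi].
    by rewrite iG (subset_trans iG) ?proper_sub.
  have -> : (F i \subset Z) = false.
    apply: contraNF neqZH => iZ; rewrite eqEsubset ZH.
    exact: subset_trans Hi iZ.
  case: ifP => // iG; move: GH; rewrite properE => /andP[_].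
  by rewrite (subset_trans Hi iG).
have [i Fi] : exists i, F i = H.
  case/support_chainP: HC => [H0|->|[i _ ->]]; last by exists i.
    by rewrite H0 properE sub0set andbF in GH.
  by apply/F_flat; rewrite setT_neq0 eqxx.
have -> : deg_in m H = deg_in m G + m i.
  rewrite /deg_in (bigD1 i) ?Fi //= addnC; congr (_ + _).
  rewrite big_mkcond [RHS]big_mkcond; apply: eq_bigr => j _.
  case: (posnP (m j)) => [-> | mj]; first by rewrite !if_same.
  have jC : F j \in support_chain m by apply/support_chainP/Or33; exists j.
  case/orP: (cons _ jC) => [jG|Hj].
    rewrite jG (subset_trans jG) ?proper_sub //=.
    suff -> : j != i by [].
    by apply: contraTneq GH => ji; rewrite properE -Fi -ji jG andbF.
  have -> : (F j \subset H) && (j != i) = false.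
    apply/negP => /andP[jH /negP[]]; apply/eqP/F_inj.
    by apply/eqP; rewrite eqEsubset Fi jH.
  case: ifP => // jG; move: GH; rewrite properE => /andP[_].
  by rewrite (subset_trans Hj jG).
rewrite -addnA ltn_add2l; case: (posnP (m i)) => [-> | mi].
  by rewrite add0n urank_proper.
have [mlt mj] := stdP _ sm i mi.
case/support_chainP: (GC) => [->|GT|[j /mj[_ mij] Gj]].
- by rewrite /urank cards0 min0n addn0 -Fi.
- by rewrite GT properE subsetT andbF in GH.
by rewrite Gj -Fi mij // -Gj Fi.
Qed.

Lemma max_avoiding m0 (x : 'I_n) : std m0 -> exists G,
  [/\ G \in support_chain m0, x \notin G &
      forall K, K \in support_chain m0 -> x \notin K -> K \subset G].
Proof.
move=> s0; pose Q G := (G \in support_chain m0) && (x \notin G).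
have Q0 : Q set0 by apply/andP; split; [exact/support_chainP/Or31 | rewrite inE].
case: (arg_maxnP (fun G : {set 'I_n} => #|G|) Q0) => G /andP[GC xG] Gmax.
exists G; split=> // K KC xK.
case/orP: (support_chain_total s0 GC KC) => // GK.
by have /eqP-> : G == K by rewrite eqEcard GK; apply: Gmax; rewrite /Q KC.
Qed.

(* Replacing each F i by the smallest member of the chain containing it can only
   increase the weight, and the new weight depends on m only through the values
   of deg_in m on the chain, where m and m0 agree. *)
Lemma nondegenerate_weight m0 m : std m0 -> nondegenerate m0 (deg_in m) ->
  weight m <= weight m0 /\ (weight m = weight m0 -> m = m0).
Proof.
move=> s0 adm.
have agree K : K \in support_chain m0 -> deg_in m K = deg_in m0 K.
  by move=> KC; have [->] := adm K.
have /choice[G GP] x := max_avoiding x s0.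
(* The set counted here is the smallest member of the chain containing F i, written so that [top]
   can be evaluated by double counting. *)
pose top m' := \sum_i m' i * #|[set x | ~~ (F i \subset G x)]|.
have topE (m' : 'X_{1..N}) : top m' + \sum_x deg_in m' (G x) = n * deg_in m' setT.
  rewrite /top /deg_in; under eq_bigr do rewrite -sum1_card big_distrr /=.
  under eq_bigr => i _ do (under eq_bigl => x do rewrite inE).
  under eq_bigr do rewrite big_mkcond.
  rewrite exchange_big -big_split /=.
  rewrite [in RHS](eq_bigl predT) => [|i]; last by rewrite subsetT.
  have -> (s : nat) : n * s = \sum_(x < n) s by rewrite sum_nat_const card_ord.
  apply: eq_bigr => x _; rewrite [X in _ + X]big_mkcond -big_split /=.
  by apply: eq_bigr => i _; rewrite muln1; case: (F i \subset G x); rewrite /= ?addn0.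
have top_eq : top m = top m0.
  apply/eqP; rewrite -(eqn_add2r (\sum_x deg_in m (G x))) topE.
  rewrite (eq_bigr (fun x => deg_in m0 (G x))) => [|x _]; last first.
    by apply: agree; case: (GP x).
  by rewrite topE agree // !inE eqxx orbT.
have sub_top i : F i \subset [set x | ~~ (F i \subset G x)].
  apply/subsetP => x xi; rewrite inE; apply/negP => /subsetP/(_ x xi).
  by case: (GP x) => _ /negP.
have le_top : weight m <= top m.
  by apply: leq_sum => i _; rewrite leq_mul2l subset_leq_card ?orbT.
have top0 : top m0 = weight m0.
  apply: eq_bigr => i _; case: (posnP (m0 i)) => [->|mi]; first by rewrite !mul0n.
  congr (_ * #|pred_of_set _|); apply/esym/eqP; rewrite eqEsubset sub_top.
  apply/subsetP => x; rewrite inE; apply: contraR => xi.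
  case: (GP x) => _ _; apply => //; apply/support_chainP/Or33; by exists i.
split=> [|eqw]; first by rewrite -top0 -top_eq.
(* Equal weights force each F i in the support to coincide with its hull in the chain. *)
have in_chain i : 0 < m i -> F i \in support_chain m0.
  move=> mi; have Ei : F i = [set x | ~~ (F i \subset G x)].
    apply/eqP; rewrite eqEcard sub_top /=.
    have : top m <= weight m by rewrite top_eq top0 eqw.
    rewrite /top /weight (bigD1 i) //= [X in _ <= X](bigD1 i) //=.
    set s1 := \sum_(j | _) _; set s2 := \sum_(j | _) _.
    have : s2 <= s1.
      by apply: leq_sum => j _; rewrite leq_mul2l subset_leq_card ?orbT.
    move=> s21 s12; rewrite -(leq_pmul2l mi) -(leq_add2r s1).
    by apply: leq_trans s12 _; rewrite leq_add2l.
  have [K [KC iK Kmin]] : exists K, [/\ K \in support_chain m0, F i \subset K &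
      forall L, L \in support_chain m0 -> F i \subset L -> K \subset L].
    pose P K := (K \in support_chain m0) && (F i \subset K).
    have PT : P setT by rewrite /P subsetT !inE eqxx orbT.
    case: (arg_minnP (fun K : {set 'I_n} => #|K|) PT) => K /andP[KC iK] Kmin.
    exists K; split=> // L LC iL; case/orP: (support_chain_total s0 KC LC) => // LK.
    by have /eqP-> : L == K by rewrite eqEcard LK; apply: Kmin; rewrite /P LC.
  suff -> : F i = K by [].
  apply/eqP; rewrite eqEsubset iK /=; apply/subsetP => x xK.
  rewrite Ei inE; apply/negP => iG; case: (GP x) => GC /negP[].
  exact: (subsetP (Kmin _ GC iG)).
apply/mnmP => i; have [c] := ubnP #|F i|; elim: c i => // c IH i lt_c.
case: (boolP (F i \in support_chain m0)) => [iC | niC]; last first.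
  have -> : m i = 0 by apply/eqP; rewrite eqn0Ngt; apply: contra niC; apply: in_chain.
  apply/esym/eqP; rewrite eqn0Ngt; apply: contra niC => mi.
  by apply/support_chainP/Or33; exists i.
have := agree _ iC; rewrite /deg_in (bigD1 i) //= [in RHS](bigD1 i) //=.
rewrite (eq_bigr m0) => [/addIn-> //|j /andP[ji neq]].
apply: IH; apply: (@leq_trans #|F i|); last exact: lt_c.
by apply: proper_card; rewrite properEneq ji andbT (inj_eq F_inj).
Qed.

End StandardMonomials.

(** * Straightening *)

Section Generators.
Variables (n N : nat) (F : 'I_N -> {set 'I_n}) (R : comNzRingType) (x : 'I_N -> R).

Definition upper_sum (A : {set 'I_n}) : R := \sum_(i | A \subset F i) x i.

Definition upper_monomial (m : 'X_{1..N}) : R := \prod_i upper_sum (F i) ^+ m i.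

Lemma upper_monomialD m m' :
  upper_monomial (m + m') = upper_monomial m * upper_monomial m'.
Proof. by rewrite -big_split; apply: eq_bigr => i _; rewrite mnmDE exprD. Qed.

Lemma upper_monomialU i c : upper_monomial (U_(i) *+ c) = upper_sum (F i) ^+ c.
Proof.
rewrite /upper_monomial (bigD1 i) //= mulmnE mnm1E eqxx mul1n big1 ?mulr1 // => j.
by rewrite mulmnE mnm1E eq_sym => /negPf->.
Qed.

Lemma upper_sumB (A B : {set 'I_n}) : A \subset B ->
  upper_sum A - upper_sum B = \sum_(i | (A \subset F i) && ~~ (B \subset F i)) x i.
Proof.
move=> AB; rewrite [upper_sum A](bigID (fun i => B \subset F i)) /=.
rewrite (_ : \sum_(i | _ && (B \subset F i)) x i = upper_sum B).
  by rewrite addrAC subrr add0r.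
by apply: eq_bigl => i; rewrite andb_idl // => /(subset_trans AB).
Qed.

End Generators.

Section Straightening.
Variables (n r N : nat) (F : 'I_N -> {set 'I_n}).
Hypotheses (r_gt0 : (0 < r)%N) (r_le_n : (r <= n)%N).
Hypothesis F_flat : forall A,
  (exists i, F i = A) <-> (A != set0) && ((A == setT) || (#|A| < r)%N).
Variables (R : comNzRingType) (x : 'I_N -> R).
Hypothesis x_linear : forall e, \sum_(i | e \in F i) x i = 0.
Hypothesis x_incomparable : forall i j,
  ~~ (F i \subset F j) -> ~~ (F j \subset F i) -> x i * x j = 0.
Local Notation rk := (urank r).
Implicit Types (e : 'I_n) (A B : {set 'I_n}) (m : 'X_{1..N}).
Local Notation h := (upper_sum F x).

Lemma upper_sum_expand e A : e \in A ->
  h A = - \sum_(i | (e \in F i) && ~~ (A \subset F i)) x i.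
Proof.
move=> eA; apply/eqP; rewrite -addr_eq0 -[X in _ == X](x_linear e).
rewrite [X in _ == X](bigID (fun i => A \subset F i)) /=; apply/eqP.
rewrite /upper_sum; congr (_ + _); apply: eq_bigl => i.
by rewrite andb_idl // => /subsetP/(_ e eA).
Qed.

(** Take e in F k outside F l and expand one factor h (F k) by the linear relation at e. A surviving
    x_i has F i containing both F l and e, so F k :&: F i has larger rank than F k :&: F l, and one
    factor less is enough. *)
Lemma x_upper_sum_nilp c l k : ~~ (F k \subset F l) ->
  (rk (F k) <= rk (F k :&: F l) + c)%N -> x l * h (F k) ^+ c = 0.
Proof.
elim: c l => [|c IH] l kl.
  rewrite addn0 leqNgt => /negP[]; apply: urank_proper; last exact: cap_small.
  by rewrite properE subsetIl subsetI subxx.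
move=> le_rk; have /subsetPn[e ek el] := kl.
rewrite exprS mulrCA {1}(upper_sum_expand ek) mulNr mulr_suml big1 ?oppr0 //.
move=> i /andP[ei ki]; rewrite mulrA.
case: (boolP (F l \subset F i)) => li; last first.
  rewrite (x_incomparable _ li) ?mul0r //.
  by apply/subsetPn; exists e.
rewrite -mulrA mulrCA IH ?mulr0 //.
rewrite (leq_trans le_rk) // addnS -addSn leq_add2r urank_proper //.
  apply/properP; split; first exact: setIS.
  by exists e; rewrite !inE ek ?ei // (negPf el).
exact: (cap_small F_flat).
Qed.

Lemma upper_sum_nilp c k : (rk (F k) <= c)%N -> h (F k) ^+ c = 0.
Proof.
have Fk0 := F_neq0 F_flat k; have /set0Pn[e ek] := Fk0.
case: c => [|c le_rk]; first by rewrite leqNgt urank_gt0.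
rewrite exprS {1}(upper_sum_expand ek) mulNr mulr_suml big1 ?oppr0 //.
move=> i /andP[ei ki]; rewrite x_upper_sum_nilp // (leq_trans le_rk) //.
rewrite -addn1 addnC leq_add2r urank_gt0 //.
by apply/set0Pn; exists e; rewrite inE ek.
Qed.

(** The difference h (F j) - h (F i) is a sum of x_l with F l containing F j but not F i, and the
    c-th power of h (F i) kills each of them. *)
Lemma upper_sum_absorb c j i : F j \subset F i ->
  (rk (F i) <= rk (F j) + c)%N -> h (F j) * h (F i) ^+ c = h (F i) ^+ c.+1.
Proof.
move=> ji le_rk; apply/eqP; rewrite exprS -subr_eq0 -mulrBl upper_sumB //.
apply/eqP; rewrite mulr_suml big1 // => l /andP[jl il].
apply: x_upper_sum_nilp => //; apply: leq_trans le_rk _.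
by rewrite leq_add2r urank_mono // subsetI ji.
Qed.

(** A flat counted in h_A - h_J contains A but not B, one counted in h_B - h_J contains B but not A;
    two such flats are incomparable. *)
Lemma upper_sum_uncross A B (J := A :|: B) :
  h A * h B = h A * h J + h J * h B - h J * h J.
Proof.
apply/eqP; rewrite -subr_eq0; apply/eqP.
transitivity ((h A - h J) * (h B - h J)); first by ring.
rewrite !upper_sumB ?subsetUl ?subsetUr // big_distrlr /=.
apply: big1 => i /andP[Ai]; rewrite subUset Ai => /= Bi.
apply: big1 => j /andP[Bj]; rewrite subUset Bj andbT => Aj.
apply: x_incomparable; first by apply: contra Aj => /(subset_trans Ai).
by apply: contra Bi => /(subset_trans Bj).
Qed.

Local Notation mon := (upper_monomial F x).
Local Notation wt := (weight F).

Lemma weightD m m' : wt (m + m')%MM = (wt m + wt m')%N.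
Proof. by rewrite -big_split; apply: eq_bigr => i _; rewrite mnmDE mulnDl. Qed.

Lemma weightU i c : wt (U_(i) *+ c)%MM = (c * #|F i|)%N.
Proof.
rewrite /weight (bigD1 i) //= mulmnE mnm1E eqxx mul1n big1 ?addn0 // => j.
by rewrite mulmnE mnm1E eq_sym => /negPf->.
Qed.

Lemma weight_le m : (wt m <= mdeg m * n)%N.
Proof.
rewrite mdegE big_distrl leq_sum // => i _.
by rewrite leq_mul2l -[n in (_ <= n)%N]card_ord max_card orbT.
Qed.

Lemma mnm_split m i j : i != j -> (0 < m j)%N ->
  exists m', m = (m' + U_(j) + U_(i) *+ m i)%MM.
Proof.
move=> ij mj; exists (m - U_(j) - U_(i) *+ m i)%MM; apply/mnmP => l.
rewrite !mnmDE !mnmBE !mulmnE !mnm1E.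
case: (eqVneq i l) => [<-|_]; first by rewrite eq_sym (negPf ij) /=; lia.
by case: (eqVneq j l) mj => [->|_]; rewrite /=; lia.
Qed.

(** A violation of [std] is an exponent too large by itself ([upper_sum_nilp]), an incomparable pair
    ([upper_sum_uncross]), or a nested pair with too large an exponent on top ([upper_sum_absorb]).
    The last two rules replace flats by larger ones. *)
Lemma std_or_straighten m : [\/ std r F m, mon m = 0,
  (exists m', [/\ mdeg m' = mdeg m, (wt m < wt m')%N & mon m = mon m']) |
  (exists m1 m2 m3, [/\ mdeg m1 = mdeg m, mdeg m2 = mdeg m & mdeg m3 = mdeg m] /\
     [/\ (wt m < wt m1)%N, (wt m < wt m2)%N, (wt m < wt m3)%N &
     mon m = mon m1 + mon m2 - mon m3])].
Proof.
case: (boolP (std r F m)) => [|nstd]; first by constructor.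
move: nstd; rewrite negb_forall => /existsP[i]; rewrite negb_imply negb_and.
case/andP=> mi /orP[mi_rk|].
  constructor 2; have -> : m = (m - U_(i) *+ m i + U_(i) *+ m i)%MM.
    apply/mnmP => l; rewrite mnmDE mnmBE mulmnE mnm1E.
    by case: (eqVneq i l) => [<-|_] /=; lia.
  rewrite upper_monomialD upper_monomialU upper_sum_nilp ?mulr0 //.
  by rewrite leqNgt.
rewrite negb_forall => /existsP[j]; rewrite negb_imply negb_and.
case/andP=> mj /orP[ij|].
  constructor 4; move: ij; rewrite negb_or => /andP[ji ij].
  have neq : j != i by apply: contraNneq ij => ->.
  have [m0 mE] := mnm_split neq mi.
  have [k [Jk _]] : exists k, (forall l, (F i :|: F j \subset F l) = (F k \subset F l)) /\
      (F k = F i :|: F j \/ F k = setT /\ (r <= #|F i :|: F j|)%N).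
    apply: (closure_index r_gt0 r_le_n F_flat).
    by rewrite setU_eq0 negb_and (F_neq0 F_flat).
  have hJ : h (F i :|: F j) = h (F k) by apply: eq_bigl.
  have : F i :|: F j \subset F k by rewrite Jk.
  rewrite subUset => /andP[ik jk].
  pose m' := (m0 + U_(j) *+ (m j).-1)%MM.
  have mE' : m = (m' + (U_(i) *+ 1 + U_(j) *+ 1))%MM.
    rewrite {1}mE /m' addmA -!addmA; congr (_ + _)%MM.
    apply/mnmP => l; rewrite !(mnmDE, mulmnE) !mnm1E; move: mj.
    by case: (i == l); case: (j == l); lia.
  exists (m' + (U_(i) *+ 1 + U_(k) *+ 1))%MM.
  exists (m' + (U_(k) *+ 1 + U_(j) *+ 1))%MM.
  exists (m' + (U_(k) *+ 1 + U_(k) *+ 1))%MM.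
  have cik : (#|F i| < #|F k|)%N.
    apply: proper_card; rewrite properE ik; apply: contra ji; exact: subset_trans.
  have cjk : (#|F j| < #|F k|)%N.
    apply: proper_card; rewrite properE jk; apply: contra ij; exact: subset_trans.
  split; first by rewrite mE' !mdegD !mdegMn !mdeg1.
  rewrite mE' !weightD !weightU; split; [lia | lia | lia |].
  rewrite !upper_monomialD !upper_monomialU !expr1 upper_sum_uncross hJ; ring.
rewrite negb_imply -leqNgt => /andP[ji mi_rk].
constructor 3; have neq : i != j by apply: contraTneq ji => ->; rewrite properxx.
have [m0 mE] := mnm_split neq mj.
have cji := proper_card ji.
exists (m0 + U_(i) *+ (m i).+1)%MM; split.
- by rewrite {2}mE !mdegD !mdegMn !mdeg1; lia.
- by rewrite {1}mE -[U_(j)%MM]mulm1n !weightD !weightU; lia.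
rewrite {1}mE -[U_(j)%MM]mulm1n !upper_monomialD !upper_monomialU expr1 -mulrA.
rewrite upper_sum_absorb ?proper_sub //; lia.
Qed.

End Straightening.

(** * Standard monomials span *)

Section Spanning.
Variables (n r N : nat) (F : 'I_N -> {set 'I_n}).
Hypotheses (r_gt0 : (0 < r)%N) (r_le_n : (r <= n)%N) (F_inj : injective F).
Hypothesis F_flat : forall A,
  (exists i, F i = A) <-> (A != set0) && ((A == setT) || (#|A| < r)%N).
Variables (K : fieldType) (R : comAlgType K) (x : 'I_N -> R).
Hypothesis x_linear : forall e, \sum_(i | e \in F i) x i = 0.
Hypothesis x_incomparable : forall i j,
  ~~ (F i \subset F j) -> ~~ (F j \subset F i) -> x i * x j = 0.
Variable S : nat -> seq 'X_{1..N}.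
Hypothesis S_uniq : forall d, uniq (S d).
Hypothesis S_mem : forall d m, (m \in S d) = std r F m && (mdeg m == d).
Local Notation mon := (upper_monomial F x).
Local Notation h := (upper_sum F x).

Definition std_span d v :=
  exists c : 'X_{1..N} -> K, v = \sum_(m <- S d) c m *: mon m.

Lemma std_span0 d : std_span d 0.
Proof. by exists (fun=> 0); rewrite big1 // => m _; rewrite scale0r. Qed.

Lemma std_spanZD d a u v : std_span d u -> std_span d v -> std_span d (a *: u + v).
Proof.
move=> [c ->] [c' ->]; exists (fun m => a * c m + c' m).
rewrite scaler_sumr -big_split; apply: eq_bigr => m _ /=.
by rewrite scalerDl scalerA.
Qed.

Lemma std_spanD d u v : std_span d u -> std_span d v -> std_span d (u + v).
Proof. by move=> /(std_spanZD 1); rewrite scale1r; apply. Qed.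

Lemma std_spanZ d a u : std_span d u -> std_span d (a *: u).
Proof. by move=> /(std_spanZD a)/(_ (std_span0 d)); rewrite addr0. Qed.

Lemma std_spanB d u v : std_span d u -> std_span d v -> std_span d (u - v).
Proof. by move=> Su /(std_spanZ (-1)); rewrite scaleN1r; apply: std_spanD. Qed.

Lemma std_span_sum d (I : Type) (s : seq I) (P : pred I) (v : I -> R) :
  (forall i, P i -> std_span d (v i)) -> std_span d (\sum_(i <- s | P i) v i).
Proof.
by move=> Sv; apply: big_ind => //; [apply: std_span0 | apply: std_spanD].
Qed.

(** The weight grows at each straightening step and is at most n times the degree. *)
Lemma std_span_upper_monomial m : std_span (mdeg m) (mon m).
Proof.
move E : (mdeg m) => d; have [c] := ubnP (d * n - weight F m)%N.
elim: c m E => // c IH m E lt_c.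
have smaller m' : mdeg m' = d -> (weight F m < weight F m')%N -> std_span d (mon m').
  move=> E' lt; apply: (IH _ E'); have := weight_le F m'; rewrite E'.
  by move: lt lt_c; clear; lia.
case: (std_or_straighten r_gt0 r_le_n F_flat x_linear x_incomparable m).
- move=> sm; exists (fun m' => (m' == m)%:R).
  rewrite (bigD1_seq m) ?S_uniq ?S_mem ?sm ?E //= eqxx scale1r big1 ?addr0 //.
  by move=> m' /negPf->; rewrite scale0r.
- by move=> ->; apply: std_span0.
- by move=> [m' [E' lt ->]]; apply: smaller => //; rewrite E' E.
move=> [m1 [m2 [m3 [[E1 E2 E3] [lt1 lt2 lt3 ->]]]]].
by apply: std_spanB; first apply: std_spanD; apply: smaller => //;
  rewrite ?E1 ?E2 ?E3 E.
Qed.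

Lemma std_span_upper_mul d v j : std_span d v -> std_span d.+1 (v * h (F j)).
Proof.
move=> [c ->]; rewrite mulr_suml big_seq; apply: std_span_sum => m.
rewrite S_mem => /andP[_ /eqP E]; rewrite -scalerAl; apply: std_spanZ.
rewrite -[h _]expr1 -upper_monomialU -upper_monomialD -E.
have -> : (mdeg m).+1 = mdeg (m + U_(j) *+ 1)%MM.
  by rewrite mdegD mdegMn mdeg1 addn1.
exact: std_span_upper_monomial.
Qed.

(** Here x_j is h (F j) minus the x_i of the flats strictly above F j, so induction goes from large
    flats to small ones. *)
Lemma std_span_gen_mul d v j : std_span d v -> std_span d.+1 (v * x j).
Proof.
move=> Sv; have [c] := ubnP (n - #|F j|)%N; elim: c j => // c IH j lt_c.
have -> : x j = h (F j) - \sum_(i | F j \proper F i) x i.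
  rewrite /upper_sum (bigD1 j) //= -addrA -[LHS]addr0; congr (_ + _).
  apply/esym/eqP; rewrite subr_eq0; apply/eqP/eq_bigl => i.
  by rewrite properEneq (inj_eq F_inj) andbC eq_sym.
rewrite mulrBr [X in _ - X]mulr_sumr; apply: std_spanB; first exact: std_span_upper_mul.
apply: std_span_sum => i ji; apply: IH; have := proper_card ji.
have := subset_leq_card (subsetT (F i)); rewrite cardsT card_ord.
by move: lt_c; clear; lia.
Qed.

Lemma std_span_gen_monomial m : std_span (mdeg m) (\prod_i x i ^+ m i).
Proof.
move E : (mdeg m) => d; elim: d m E => [|d IH] m E.
  have -> : \prod_i x i ^+ m i = mon 0%MM.
    move/eqP: E; rewrite mdeg_eq0 => /eqP->.
    by rewrite /upper_monomial !big1 // => i _; rewrite mnm0E expr0.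
  by rewrite -[0%N](@mdeg0 N); apply: std_span_upper_monomial.
have [i mi] : exists i, (0 < m i)%N.
  apply/existsP; apply: contraT; rewrite negb_exists => /forallP m0.
  have : (0 < mdeg m)%N by rewrite E.
  by rewrite mdegE big1 // => i _; apply/eqP; rewrite eqn0Ngt.
have mE : m = (m - U_(i) + U_(i))%MM.
  apply/mnmP => l; rewrite mnmDE mnmBE mnm1E.
  by case: (eqVneq i l) mi => [->|_]; rewrite /=; lia.
have -> : \prod_l x l ^+ m l = (\prod_l x l ^+ (m - U_(i))%MM l) * x i.
  rewrite mE; under eq_bigr do rewrite mnmDE exprD.
  rewrite big_split /=; congr (_ * _); first by rewrite -mE.
  rewrite (bigD1 i) //= mnm1E eqxx expr1 big1 ?mulr1 // => l.
  by rewrite mnm1E eq_sym => /negPf->.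
apply/std_span_gen_mul/IH; have := congr1 mdeg mE.
by rewrite mdegD mdeg1 E addn1 => -[].
Qed.

End Spanning.

(** * Linear forms vanishing on the relations *)

Section PairingFunctional.
Variables (n r N : nat) (F : 'I_N -> {set 'I_n}).
Hypotheses (r_gt0 : (0 < r)%N) (r_le_n : (r <= n)%N) (F_inj : injective F).
Hypothesis F_flat : forall A,
  (exists i, F i = A) <-> (A != set0) && ((A == setT) || (#|A| < r)%N).
Variable K : fieldType.
Local Notation P := {mpoly K[N]}.

Definition zeta_mx : 'M[K]_N := \matrix_(i, j) (F i \subset F j)%:R.

Lemma zeta_mx_unit : zeta_mx \in unitmx.
Proof.
rewrite -row_free_unit; apply: inj_row_free => v v0.
apply/eqP; apply: contraT => nz.
have [i0 vi0] : exists i, v 0 i != 0.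
  apply/existsP; apply: contraR nz; rewrite negb_exists => /forallP vz.
  by apply/eqP/rowP => i; rewrite mxE; apply/eqP; have := vz i; rewrite negbK.
case: (arg_minnP (fun i => #|F i|) (vi0 : (fun i => v 0 i != 0) i0)) => i vi imin.
have := congr1 (fun w : 'rV_N => w 0 i) v0; rewrite !mxE (bigD1 i) //= mxE subxx.
rewrite mulr1 big1 ?addr0 => [v0i|j ji]; first by rewrite v0i eqxx in vi.
rewrite mxE; case: (eqVneq (v 0 j) 0) => [->|vj]; first by rewrite mul0r.
case: (boolP (F j \subset F i)) => [Fji|]; last by rewrite mulr0.
have /eqP/F_inj/eqP : F j == F i by rewrite eqEcard Fji imin.
by rewrite (negPf ji).
Qed.

(** Moebius inversion: in the target ring X_k stands for h (F k), and this is x_i in those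
    variables. *)
Definition moebius_gen i : P := \sum_k invmx zeta_mx i k *: 'X_k.

Lemma moebius_gen_sum i :
  \sum_(j | F i \subset F j) moebius_gen j = 'X_i.
Proof.
rewrite big_mkcond /=.
transitivity (\sum_k (zeta_mx *m invmx zeta_mx) i k *: ('X_k : P)).
  under [RHS]eq_bigr do rewrite mxE scaler_suml.
  rewrite exchange_big; apply: eq_bigr => j _ /=.
  under eq_bigr do rewrite -scalerA.
  by rewrite -scaler_sumr mxE; case: ifP; rewrite ?scale1r ?scale0r.
rewrite mulmxV ?zeta_mx_unit // (bigD1 i) //= mxE eqxx scale1r big1 ?addr0 //.
by move=> k; rewrite mxE eq_sym => /negPf->; rewrite scale0r.
Qed.

Definition to_moebius (p : P) : P := p \mPo [tuple moebius_gen i | i < N].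

Lemma to_moebiusX i : to_moebius 'X_i = moebius_gen i.
Proof. by rewrite /to_moebius comp_mpolyXU -tnth_nth tnth_mktuple. Qed.

Local Notation xgen := (fun i => 'X_i : P).
Local Notation h := (upper_sum F xgen).

Lemma to_moebius_upper_sum i : to_moebius (h (F i)) = 'X_i.
Proof.
rewrite /to_moebius /upper_sum rmorph_sum -moebius_gen_sum /=.
by apply: eq_bigr => j _; apply: to_moebiusX.
Qed.

Lemma to_moebius_upper_monomial m :
  to_moebius (upper_monomial F xgen m) = 'X_[m].
Proof.
rewrite /to_moebius rmorph_prod mpolyXE_id /=; apply: eq_bigr => i _.
by rewrite rmorphXn /= -/(to_moebius _) to_moebius_upper_sum.
Qed.

Variable m0 : 'X_{1..N}.
Hypothesis m0_std : std r F m0.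
Local Notation adm := (nondegenerate r F m0).

(** Bounding the degree makes the sum finite and loses no admissible monomial, because the condition
    at [setT] forces the degree of m0. *)
Definition nondeg_sum (p : P) : K :=
  \sum_(m : 'X_{1..N < (mdeg m0).+1}) p@_m * `[< adm (deg_in F m) >]%:R.

Lemma nondeg_sum_is_scalar : scalar nondeg_sum.
Proof.
move=> a p q; rewrite /nondeg_sum mulr_sumr -big_split; apply: eq_bigr => m _.
by rewrite mcoeffD mcoeffZ mulrDl mulrA.
Qed.
HB.instance Definition _ :=
  GRing.isLinear.Build K P K *%R nondeg_sum nondeg_sum_is_scalar.

Lemma nondeg_sumX m : nondeg_sum 'X_[m] = `[< adm (deg_in F m) >]%:R.
Proof.
rewrite /nondeg_sum; case: (ltnP (mdeg m) (mdeg m0).+1) => [lt_m|gt_m].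
  rewrite (bigD1 (BMultinom lt_m)) //= mcoeffX eqxx mul1r big1 ?addr0 // => m' ne.
  rewrite mcoeffX; case: eqP => [E|_]; last by rewrite mul0r.
  by case/eqP: ne; apply/val_inj.
rewrite big1 => [|m' _]; last first.
  rewrite mcoeffX; case: eqP => [E|_]; last by rewrite mul0r.
  by have := bmdeg m'; rewrite -E ltnNge gt_m.
case: asboolP => // /(_ setT)[+ _].
rewrite !deg_inT => /(_ _)E; move: gt_m; rewrite E ?ltnn //.
exact/support_chainP/Or32.
Qed.

Lemma nondeg_sum_mul p s : (forall m, nondeg_sum ('X_[m] * s) = 0) ->
  nondeg_sum (p * s) = 0.
Proof.
move=> s0; rewrite [p]mpolyE mulr_suml linear_sum big1 // => m _.
by rewrite -scalerAl linearZ /= s0 mulr0.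
Qed.

Lemma nondeg_sum_mul_rank1 m k : (urank r (F k) <= 1)%N ->
  nondeg_sum ('X_[m] * 'X_k) = 0.
Proof.
move=> k1; rewrite -mpolyXD nondeg_sumX; case: asboolP => // admk; exfalso.
have C0 : set0 \in support_chain F m0 by apply/support_chainP/Or31.
have CT : setT \in support_chain F m0 by apply/support_chainP/Or32.
apply: (admissible_rank1 (@urank_submod n r) _ C0 CT (F_neq0 F_flat k) k1
  (deg_in_mono F m)); last first.
  by move=> Z; rewrite -deg_inU -deg_inD; apply: admk.
by move=> A B; apply: support_chain_total m0_std.
Qed.

(** F k is the closure of J = F a :|: F b. [admissible_exchange] speaks of J itself, and
    [nondegenerate_flats] passes to the closure. *)
Lemma nondeg_sum_uncross m a b k :
  (forall l, (F a :|: F b \subset F l) = (F k \subset F l)) ->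
  F k = F a :|: F b \/ F k = setT /\ (r <= #|F a :|: F b|)%N ->
  nondeg_sum ('X_[m] * (('X_a - 'X_k) * ('X_b - 'X_k))) = 0.
Proof.
move=> Jk kE; set J := F a :|: F b in Jk kE.
have JZ Z : (Z == setT) || (#|Z| < r)%N -> (F k \subset Z) = (J \subset Z).
  case/orP=> [/eqP->|Zr]; first by rewrite !subsetT.
  case: kE => [-> //|[-> rJ]].
  have big (A : {set 'I_n}) : (r <= #|A|)%N -> (A \subset Z) = false.
    by move=> rA; apply/negP => /subset_leq_card; move: Zr rA; clear; lia.
  by rewrite !big // cardsT card_ord.
pose f (A B : {set 'I_n}) Z := (deg_in F m Z + (A \subset Z) + (B \subset Z))%N.
have f_mono A B Z : (f A B Z <= f A B setT)%N.
  by rewrite /f !subsetT !leq_add ?leq_b1 // deg_in_mono ?subsetT.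
have XE c d (A B : {set 'I_n}) : (forall Z : {set 'I_n}, (Z == setT) || (#|Z| < r)%N ->
      (F c \subset Z) = (A \subset Z)) ->
    (forall Z, (Z == setT) || (#|Z| < r)%N -> (F d \subset Z) = (B \subset Z)) ->
    nondeg_sum ('X_[m] * ('X_c * 'X_d)) = `[< adm (f A B) >]%:R.
  move=> cA dB; rewrite mulrA -!mpolyXD nondeg_sumX; congr (nat_of_bool _)%:R.
  apply: asbool_equiv_eq; have dE Z : deg_in F (m + U_(c) + U_(d)) Z = f (F c) (F d) Z.
    by rewrite !deg_inD !deg_inU.
  split; apply: (nondegenerate_flats r_gt0 r_le_n F_flat) => Z; rewrite ?dE //.
  - by move=> Zf; rewrite /f cA ?dB.
  by move=> Zf; rewrite /f cA ?dB.
have self c Z : (Z == setT) || (#|Z| < r)%N -> (F c \subset Z) = (F c \subset Z) by [].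
have -> : 'X_[m] * (('X_a - 'X_k) * ('X_b - 'X_k)) =
    ('X_[m] * ('X_a * 'X_b) + 'X_[m] * ('X_k * 'X_k)) -
    ('X_[m] * ('X_a * 'X_k) + 'X_[m] * ('X_k * 'X_b)) :> P by ring.
rewrite linearB !linearD /=.
rewrite (XE a b _ _ (self a) (self b)) (XE k k _ _ JZ JZ).
rewrite (XE a k _ _ (self a) JZ) (XE k b _ _ JZ (self b)) -!natrD.
apply/eqP; rewrite subr_eq0; apply/eqP; congr (_%:R).
have C0 : set0 \in support_chain F m0 by apply/support_chainP/Or31.
have chain (A B : {set 'I_n}) : A \in support_chain F m0 ->
    B \in support_chain F m0 -> (A \subset B) || (B \subset A).
  exact: support_chain_total m0_std.
exact: (admissible_exchange (deg_in F m0) (@urank_submod n r) chain (F a) (F b)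
  (deg_in_super F m)).
Qed.

Definition pairing p := nondeg_sum (to_moebius p).

(** In the variables h_F the relation is X_k, with F k the closure of {e}, which has rank 1. *)
Lemma pairing_linear q e : pairing (q * \sum_(i | e \in F i) 'X_i) = 0.
Proof.
have [] := closure_index r_gt0 r_le_n F_flat (A := [set e]).
  by apply/set0Pn; exists e; rewrite inE.
move=> k [ek kE]; rewrite /pairing /to_moebius rmorphM rmorph_sum /=.
apply: nondeg_sum_mul => m; rewrite (eq_bigl (fun i => F k \subset F i)) => [|i].
  under eq_bigr do rewrite -/(to_moebius _) to_moebiusX.
  rewrite moebius_gen_sum nondeg_sum_mul_rank1 //.
  by case: kE => [->|[->]]; rewrite /urank ?cardsT ?cards1 ?card_ord; lia.
by rewrite -ek sub1set.
Qed.

(** Let F k be the closure of F i :|: F j. The product (X_i - X_k) (X_j - X_k), on which the form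
    vanishes, expands over flats F a above F i and F b above F j, neither containing F k. Such pairs
    are again incomparable, and all but (i, j) are larger, so induction applies to them. *)
Lemma pairing_quadratic q i j : ~~ (F i \subset F j) -> ~~ (F j \subset F i) ->
  pairing (q * ('X_i * 'X_j)) = 0.
Proof.
move=> ij ji; rewrite /pairing /to_moebius !rmorphM /= -!/(to_moebius _).
rewrite !to_moebiusX; apply: nondeg_sum_mul => m; clear q.
have [c] := ubnP (2 * n - #|F i| - #|F j|)%N; elim: c i j ij ji => // c IH i j ij ji lt_c.
have [] := closure_index r_gt0 r_le_n F_flat (A := F i :|: F j).
  by rewrite setU_eq0 negb_and (F_neq0 F_flat).
move=> k [Jk kE]; have := nondeg_sum_uncross m Jk kE.
have kJ l : (F k \subset F l) = (F i \subset F l) && (F j \subset F l).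
  by rewrite -Jk subUset.
have /andP[ik jk] : (F i \subset F k) && (F j \subset F k) by rewrite -kJ.
have diffE a : F a \subset F k -> 'X_a - 'X_k =
    \sum_(l | (F a \subset F l) && ~~ (F k \subset F l)) moebius_gen l :> P.
  move=> ak; rewrite -!moebius_gen_sum.
  rewrite -[LHS]/(upper_sum F moebius_gen (F a) - upper_sum F moebius_gen (F k)).
  exact: upper_sumB.
rewrite !diffE // big_distrlr /= mulr_sumr linear_sum (bigD1 i) /=; last first.
  by rewrite kJ subxx negb_and ji.
rewrite mulr_sumr linear_sum (bigD1 j) /=; last first.
  by rewrite kJ subxx negb_and ij.
have vanish a b : F i \subset F a -> ~~ (F k \subset F a) -> F j \subset F b ->
    ~~ (F k \subset F b) -> (a != i) || (b != j) ->
    nondeg_sum ('X_[m] * (moebius_gen a * moebius_gen b)) = 0.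
  move=> ia; rewrite kJ ia /= => ja jb; rewrite kJ jb andbT => ib neq.
  apply: IH.
  - by apply: contra ib; apply: subset_trans.
  - by apply: contra ja; apply: subset_trans.
  have ca := subset_leq_card ia; have cb := subset_leq_card jb.
  have lea : (#|F a| <= n)%N by rewrite -[n in (_ <= n)%N]card_ord max_card.
  have leb : (#|F b| <= n)%N by rewrite -[n in (_ <= n)%N]card_ord max_card.
  have : (#|F i| < #|F a|)%N || (#|F j| < #|F b|)%N.
    case/orP: neq => neq; apply/orP; [left|right]; apply: proper_card;
      by rewrite properEneq (inj_eq F_inj) eq_sym neq.
  by move: ca cb lea leb lt_c; clear; lia.
rewrite big1 ?addr0 => [|b /andP[/andP[jb kb] bj]]; last first.
  by apply: vanish; rewrite ?bj ?orbT // kJ subxx negb_and ji.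
rewrite big1 ?addr0 => [//|a /andP[/andP[ia ka] ai]].
rewrite mulr_sumr linear_sum big1 // => b /andP[jb kb].
by apply: vanish; rewrite ?ai.
Qed.

Lemma pairing_upper_monomial m :
  pairing (upper_monomial F xgen m) = `[< adm (deg_in F m) >]%:R.
Proof. by rewrite /pairing to_moebius_upper_monomial nondeg_sumX. Qed.

Lemma pairing_is_scalar : scalar pairing.
Proof.
by move=> a p q; rewrite /pairing /to_moebius comp_mpolyD comp_mpolyZ linearP.
Qed.
HB.instance Definition _ :=
  GRing.isLinear.Build K P K *%R pairing pairing_is_scalar.

End PairingFunctional.

(** Pairing with m0 isolates its coefficient: by [nondegenerate_weight] any other contributing
    monomial has smaller weight, hence coefficient zero by induction. *)
Lemma upper_monomials_independent (n r N : nat) (F : 'I_N -> {set 'I_n})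
    (r_gt0 : (0 < r)%N) (r_le_n : (r <= n)%N) (F_inj : injective F)
    (F_flat : forall A,
      (exists i, F i = A) <-> (A != set0) && ((A == setT) || (#|A| < r)%N))
    (K : fieldType) (S : seq 'X_{1..N}) (c : 'X_{1..N} -> K) :
  uniq S -> (forall m, m \in S -> std r F m) ->
  (forall m0, std r F m0 -> pairing r F m0
     (\sum_(m <- S) c m *: upper_monomial F (fun i => 'X_i) m) = 0) ->
  forall m, m \in S -> c m = 0.
Proof.
move=> S_uniq S_std c0 m; have [b] := ubnP (weight F m).
elim: b m => // b IH m0 lt_b mS; have := c0 m0 (S_std _ mS).
rewrite linear_sum (bigD1_seq m0) //= linearZ /= (pairing_upper_monomial r F_inj).
rewrite asboolT ?mulr1; last first.
  exact: (std_nondegenerate r_gt0 r_le_n F_inj F_flat (S_std _ mS)).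
rewrite big_seq_cond big1 ?addr0 // => m /andP[mS' ne].
rewrite linearZ /= (pairing_upper_monomial r F_inj).
case: (asboolP (nondegenerate r F m0 (deg_in F m))) => [adm|_]; last first.
  by rewrite mulr0.
have [le eq] := nondegenerate_weight F_inj (S_std _ mS) adm.
rewrite IH ?mul0r //; apply: leq_trans (_ : weight F m0 <= b)%N => //.
rewrite ltn_neqAle le andbT; apply: contraNneq ne; move=> /eq->; exact: eqxx.
Qed.

(** * Counting standard monomials *)

Section CountStandard.
Variables (n r N : nat) (F : 'I_N -> {set 'I_n}).
Hypotheses (r_gt0 : (0 < r)%N) (r_le_n : (r <= n)%N) (F_inj : injective F).
Hypothesis F_flat : forall A,
  (exists i, F i = A) <-> (A != set0) && ((A == setT) || (#|A| < r)%N).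
Local Notation rk := (urank r).
Implicit Types (m : 'X_{1..N}) (i j : 'I_N) (Q : pred 'I_N).

Definition top_rank m := (\max_(i | (0 < m i)%N) rk (F i))%N.

Definition with_zero (T : 'I_N -> seq 'X_{1..N}) Q : seq 'X_{1..N} :=
  0%MM :: [seq m | j <- [seq j <- enum 'I_N | Q j], m <- T j].

(** The standard monomials with largest flat F i, as a power of X_i times a standard monomial m
    below it. The strict bound in [std] lets the exponent run from 1 to rk (F i) - top_rank m - 1.
    The fuel [k] should exceed the size of F i. *)
Fixpoint std_top k i : seq 'X_{1..N} :=
  if k is k'.+1 then
    [seq (m + U_(i) *+ a)%MM |
       m <- with_zero (std_top k') (fun j => F j \proper F i),
       a <- iota 1 (rk (F i) - top_rank m).-1]
  else [::].

Definition has_top i m :=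
  [/\ std r F m, (0 < m i)%N & forall j, (0 < m j)%N -> F j \subset F i].

Lemma std0 : std r F 0%MM.
Proof. by apply/stdP => i; rewrite mnm0E. Qed.

Lemma top_rank0 : top_rank 0%MM = 0%N.
Proof. by apply: big_pred0 => i; rewrite mnm0E. Qed.

Lemma has_top_rank i m : has_top i m -> top_rank m = rk (F i).
Proof.
case=> _ mi top; apply/eqP; rewrite eqn_leq; apply/andP; split.
  by apply/bigmax_leqP => j /top; apply: urank_mono.
exact: (@leq_bigmax_cond _ (fun j => (0 < m j)%N) (fun j => rk (F j)) _ mi).
Qed.

Lemma std_has_top m : std r F m -> m != 0%MM -> exists i, has_top i m.
Proof.
move=> sm nz; have [i0 mi0] : exists i, (0 < m i)%N.
  apply/existsP; apply: contraR nz; rewrite negb_exists => /forallP m0.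
  by apply/eqP/mnmP => i; rewrite mnm0E; apply/eqP; rewrite eqn0Ngt.
case: (arg_maxnP (fun i => #|F i|) (mi0 : (fun i => (0 < m i)%N) i0)) => i mi imax.
exists i; split=> // j mj; case/orP: (std_chain sm mi mj) => // ij.
by have /eqP-> : F i == F j by rewrite eqEcard ij; apply: imax.
Qed.

Lemma mem_with_zero T Q : (forall j m, Q j -> m \in T j <-> has_top j m) ->
  (forall i j, Q i -> F j \subset F i -> Q j) ->
  forall m, m \in with_zero T Q <-> std r F m /\ forall j, (0 < m j)%N -> Q j.
Proof.
move=> TP Qdown m; rewrite inE; split.
  case/orP=> [/eqP->|/allpairsPdep[j [m' [+ + ->]]]].
    by split=> [|j]; [exact: std0 | rewrite mnm0E].
  rewrite mem_filter => /andP[Qj _] /(TP _ _ Qj)[sm _ top].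
  by split=> // l /top; apply: Qdown.
move=> [sm mQ]; case: (eqVneq m 0%MM) => //= nz.
have [j tj] := std_has_top sm nz; have Qj : Q j by case: tj => _ /mQ.
apply/allpairsPdep; exists j, m; split=> //; last exact/TP.
by rewrite mem_filter Qj mem_enum.
Qed.

Lemma with_zero_uniq T Q : (forall j m, Q j -> m \in T j <-> has_top j m) ->
  (forall j, Q j -> uniq (T j)) -> uniq (with_zero T Q).
Proof.
move=> TP Tuniq /=; apply/andP; split.
  apply/negP => /allpairsPdep[j [m' [+ + m0]]].
  by rewrite mem_filter => /andP[Qj _] /(TP _ _ Qj)[_]; rewrite -m0 mnm0E.
apply: allpairs_uniq_dep => [|j|].
- by rewrite filter_uniq ?enum_uniq.
- by rewrite mem_filter => /andP[/Tuniq].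
move=> _ _ /allpairsPdep[j [m [+ + ->]]] /allpairsPdep[j' [m' [+ + ->]]] /=.
rewrite !mem_filter => /andP[Qj _] /(TP _ _ Qj)[_ mj jtop].
move=> /andP[Qj' _] /(TP _ _ Qj')[_ mj' j'top] E; rewrite E in mj jtop *.
have /F_inj-> // : F j = F j'.
by apply/eqP; rewrite eqEsubset jtop // j'top.
Qed.

Lemma sum_with_zero (D : comNzRingType) (f : 'X_{1..N} -> D) T Q :
  \sum_(m <- with_zero T Q) f m = f 0%MM + \sum_(j | Q j) \sum_(m <- T j) f m.
Proof.
by rewrite big_cons big_allpairs_dep big_filter big_enum_cond.
Qed.

(** The term f 0 accounts for the empty flat; the flats properly below A are its proper subsets with
    fewer than r elements. *)
Lemma sum_flats (D : comNzRingType) (f : nat -> D) (A : {set 'I_n}) : A != set0 ->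
  f 0%N + \sum_(j | F j \proper A) f #|F j| =
    \sum_(s < rk A) f s *+ 'C(#|A|, s).
Proof.
move=> A0.
transitivity (\sum_(B : {set 'I_n} | (B \proper A) && (#|B| < r)%N) f #|B|).
  rewrite (bigD1 set0) /=; last by rewrite cards0 r_gt0 andbT proper0.
  rewrite cards0; congr (_ + _).
  rewrite -(big_imset (fun B : {set 'I_n} => f #|B|)) /=; last first.
    by move=> i j _ _; apply: F_inj.
  apply: eq_bigl => B; apply/imsetP/andP => [[j jA ->]|[/andP[BA Br] B0]].
    have jT : F j != setT.
      apply: contraTneq (jA : F j \proper A) => ->.
      by rewrite properE subsetT andbF.
    by rewrite [_ \proper _]jA (F_small F_flat jT) (F_neq0 F_flat).
  have [_ []] := F_flat B; first by rewrite B0 Br orbT.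
  by move=> j jB; exists j; [rewrite -jB in BA|].
rewrite (partition_big (fun B : {set 'I_n} => inord #|B| : 'I_n.+1) predT) //=.
have inordE (B : {set 'I_n}) : (inord #|B| : 'I_n.+1) = #|B| :> nat.
  by rewrite inordK // ltnS; have := max_card (mem B); rewrite card_ord.
rewrite (big_ord_widen n.+1 (fun s => f s *+ 'C(#|A|, s))); last first.
  by rewrite /urank; lia.
rewrite [RHS]big_mkcond; apply: eq_bigr => s _; case: ifP => sA; last first.
  rewrite big1 // => B /andP[/andP[/proper_card BA Br] /eqP E].
  by move: sA; rewrite -E inordE leq_min BA Br.
rewrite (eq_bigr (fun=> f s)) => [|B /andP[_ /eqP <-]]; last by rewrite inordE.
rewrite sumr_const; congr (_ *+ _); rewrite -cards_draws.
apply: eq_card => B; rewrite [RHS]inE [LHS]unfold_in; apply/andP/andP.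
  move=> [/andP[/proper_sub BA _] /eqP E]; split=> //.
  by rewrite -inordE E.
move=> [BA /eqP E]; split; last by rewrite -val_eqE /= inordE E.
by move: sA; rewrite -E leq_min properEcard BA.
Qed.

(** Once the power of X_i is split off, the bounds on its exponent against all smaller flats of the
    support reduce to the one given by [top_rank]. *)
Lemma mem_std_top k i m : (#|F i| < k)%N -> m \in std_top k i <-> has_top i m.
Proof.
elim: k i m => // k IH i m lt_k.
have IH' j m' : F j \proper F i -> m' \in std_top k j <-> has_top j m'.
  by move=> /proper_card ji; apply: IH; move: ji lt_k; clear; lia.
have down j l : F j \proper F i -> F l \subset F j -> F l \proper F i.
  by move=> ji lj; apply: sub_proper_trans ji.
split=> [/allpairsPdep[m' [a [+ + ->]]]|[sm mi top]].
  rewrite mem_iota => /(mem_with_zero IH' down)[sm' m'top] /andP[a0 lta].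
  have {}lta : (a + top_rank m' < rk (F i))%N.
    by move: a0 lta; clear; lia.
  have m'i : m' i = 0%N.
    by apply/eqP; rewrite eqn0Ngt; apply/negP => /m'top; rewrite properxx.
  have mE l : (m' + U_(i) *+ a)%MM l = if l == i then a else m' l.
    rewrite mnmDE mulmnE mnm1E eq_sym; case: eqP => [->|_] /=.
      by rewrite m'i mul1n.
    by rewrite addn0.
  have le_top j : (0 < m' j)%N -> (rk (F j) <= top_rank m')%N.
    exact: (@leq_bigmax_cond _ (fun j => (0 < m' j)%N) (fun j => rk (F j))).
  split; last 2 first.
  - by rewrite mE eqxx.
  - by move=> j; rewrite mE; case: eqP => [-> //|_ /m'top/proper_sub].
  apply/stdP => l; rewrite mE; case: eqP => [-> _|_ ml].
    split=> [|j]; first by move: lta; clear; lia.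
    rewrite mE; case: eqP => [-> _|_ mj]; first by rewrite subxx properxx.
    rewrite proper_sub ?m'top //; split=> // _.
    by move: (le_top _ mj) lta; clear; lia.
  have /stdP/(_ l ml)[ltl lj] := sm'; split=> // j; rewrite mE.
  case: eqP => [-> _|_ /lj //]; have li := m'top _ ml.
  rewrite (proper_sub li) orbT; split=> // il.
  by have := proper_trans il li; rewrite properxx.
pose m' := (m - U_(i) *+ m i)%MM.
have m'E l : m' l = if l == i then 0%N else m l.
  rewrite mnmBE mulmnE mnm1E eq_sym; case: eqP => [->|_] /=.
    by rewrite mul1n subnn.
  by rewrite subn0.
have m'm l : (0 < m' l)%N -> (0 < m l)%N /\ l != i.
  by rewrite m'E; case: eqP.
have /stdP smP := sm.
have m'top l : (0 < m' l)%N -> F l \proper F i.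
  by move=> /m'm[ml li]; rewrite properEneq top // (inj_eq F_inj) li.
apply/allpairsPdep; exists m', (m i); split; last first.
- apply/mnmP => l; rewrite mnmDE m'E mulmnE mnm1E eq_sym.
  by case: eqP => [->|_] /=; rewrite ?mul1n ?addn0.
- rewrite mem_iota mi /=.
  suff : (m i + top_rank m' < rk (F i))%N by clear; lia.
  have [mlt mlow] := smP i mi.
  suff : (top_rank m' <= rk (F i) - (m i).+1)%N by move: mlt; clear; lia.
  apply/bigmax_leqP => l m'l; have [ml li] := m'm l m'l.
  have [_ /(_ (m'top l m'l))] := mlow l ml; clear; lia.
apply/(mem_with_zero IH' down); split=> //; apply/stdP => l m'l.
have [ml li] := m'm l m'l; have [ltl lj] := smP l ml.
rewrite m'E (negPf li); split=> // j /m'm[mj _]; exact: lj.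
Qed.

Lemma std_top_uniq k i : (#|F i| < k)%N -> uniq (std_top k i).
Proof.
elim: k i => // k IH i lt_k.
have IH' j : F j \proper F i -> (#|F j| < k)%N.
  by move=> /proper_card ji; move: ji lt_k; clear; lia.
have IHmem j m : F j \proper F i -> m \in std_top k j <-> has_top j m.
  by move=> /IH'; apply: mem_std_top.
have down j l : F j \proper F i -> F l \subset F j -> F l \proper F i.
  by move=> ji lj; apply: sub_proper_trans ji.
apply: allpairs_uniq_dep => [|m _|]; last 2 first.
- exact: iota_uniq.
- move=> _ _ /allpairsPdep[m [a [+ _ ->]]] /allpairsPdep[m' [a' [+ _ ->]]] /=.
  move=> /(mem_with_zero IHmem down)[_ mtop] /(mem_with_zero IHmem down)[_ m'top] E.
  have mi : m i = 0%N.
    by apply/eqP; rewrite eqn0Ngt; apply/negP => /mtop; rewrite properxx.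
  have m'i : m' i = 0%N.
    by apply/eqP; rewrite eqn0Ngt; apply/negP => /m'top; rewrite properxx.
  have El l := congr1 (fun M : 'X_{1..N} => M l) E.
  have := El i; rewrite !mnmDE !mulmnE mnm1E eqxx mi m'i !mul1n !add0n => aa'.
  have /addIm -> : (m + U_(i) *+ a')%MM = (m' + U_(i) *+ a')%MM by rewrite -{1}aa'.
  by rewrite aa'.
apply: with_zero_uniq => // j /IH'; exact: IH.
Qed.

Section GeneratingFunction.
Variables (D : comNzRingType) (t : D).
Local Notation gf T := (\sum_(m <- T) t ^+ mdeg m).

Lemma std_top_gf_rec k i : (#|F i| < k.+1)%N -> gf (std_top k.+1 i) =
  t * geom t (rk (F i)).-1 + \sum_(j | F j \proper F i)
    gf (std_top k j) * (t * geom t (rk (F i) - rk (F j)).-1).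
Proof.
move=> lt_k; rewrite -[std_top k.+1 i]/[seq (m + U_(i) *+ a)%MM |
  m <- with_zero (std_top k) (fun j => F j \proper F i),
  a <- iota 1 (rk (F i) - top_rank m).-1] big_allpairs_dep.
transitivity (\sum_(m <- with_zero (std_top k) (fun j => F j \proper F i))
    t ^+ mdeg m * (t * geom t (rk (F i) - top_rank m).-1)).
  apply: eq_bigr => m _; set c := _.-1.
  rewrite -[iota 1 c]/(iota (1 + 0) c) iotaDl big_map /geom !mulr_sumr.
  rewrite -(big_mkord predT (fun a => t ^+ mdeg m * (t * t ^+ a))).
  rewrite /index_iota subn0; apply: eq_bigr => a _.
  by rewrite mdegD mdegMn mdeg1 mul1n exprD exprS.
rewrite sum_with_zero top_rank0 subn0 mdeg0 expr0 mul1r; congr (_ + _).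
apply: eq_bigr => j ji; rewrite mulr_suml big_seq [RHS]big_seq.
apply: eq_bigr => m; have lt_j : (#|F j| < k)%N.
  by move: (proper_card ji) lt_k; clear; lia.
by move=> /(mem_std_top _ lt_j)/has_top_rank->.
Qed.

(** The rank of a proper flat is its size and all its subsets are flats, so the recursion is that of
    the derangement polynomials. *)
Lemma std_top_gf k i : (#|F i| < k)%N -> F i != setT ->
  gf (std_top k i) = der t #|F i|.
Proof.
elim: k i => // k IH i lt_k iT; rewrite std_top_gf_rec //.
have rkE (A : {set 'I_n}) : (#|A| < r)%N -> rk A = #|A| by move=> Ar; rewrite /urank; lia.
have iE := rkE _ (F_small F_flat iT).
rewrite (eq_bigr (fun j => der t #|F j| * (t * geom t (#|F i| - #|F j|).-1))).
  have := sum_flats (fun s => der t s * (t * geom t (#|F i| - s).-1)) (F_neq0 F_flat i).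
  rewrite /= der0 mul1r subn0 iE => ->.
  by rewrite derE // card_gt0 (F_neq0 F_flat).
move=> j ji; have lt_j : (#|F j| < k)%N.
  by move: (proper_card ji) lt_k; clear; lia.
have jT : F j != setT.
  by apply: contraTneq ji => ->; rewrite properE subsetT andbF.
by rewrite IH // iE (rkE _ (F_small F_flat jT)).
Qed.

Definition std_all := with_zero (std_top n.+1) predT.

Lemma card_F_lt i : (#|F i| < n.+1)%N.
Proof. by rewrite ltnS; have := max_card (mem (F i)); rewrite card_ord. Qed.

Lemma mem_std_all m : (m \in std_all) = std r F m.
Proof.
have mem_top j m' : predT j -> m' \in std_top n.+1 j <-> has_top j m'.
  by move=> _; apply/mem_std_top/card_F_lt.
by apply/idP/idP => [/(mem_with_zero mem_top)[]//|sm]; apply/(mem_with_zero mem_top).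
Qed.

Lemma std_all_uniq : uniq std_all.
Proof.
apply: with_zero_uniq => [j m _|j _]; first exact/mem_std_top/card_F_lt.
exact/std_top_uniq/card_F_lt.
Qed.

(** Each flat of size s < r gives d_s from monomials avoiding the ground set and d_s t [r-s-1]_t
    from those with the ground set on top, together d_s [r-s]_t. *)
Lemma std_all_gf : gf std_all = uniform_hilbert t r n.
Proof.
have [_ []] := F_flat setT; first by rewrite (setT_neq0 r_gt0 r_le_n) eqxx.
move=> i0 Fi0; rewrite sum_with_zero mdeg0 expr0 (bigD1 i0) // addrCA.
rewrite (eq_bigr (fun j => der t #|F j|)) => [|j ji]; last first.
  by rewrite std_top_gf ?card_F_lt // -Fi0 (inj_eq F_inj).
rewrite (eq_bigl (fun j => F j \proper F i0)) => [|j]; last first.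
  by rewrite properEneq Fi0 subsetT andbT -Fi0 (inj_eq F_inj).
have rkT : rk (F i0) = r by rewrite Fi0 /urank cardsT card_ord; lia.
rewrite -{1}(der0 t) (sum_flats (der t) (F_neq0 F_flat i0)).
rewrite std_top_gf_rec ?card_F_lt //.
rewrite (eq_bigr (fun j => der t #|F j| * (t * geom t (rk (F i0) - #|F j|).-1))).
  have := sum_flats (fun s => der t s * (t * geom t (rk (F i0) - s).-1))
    (F_neq0 F_flat i0).
  rewrite /= der0 mul1r subn0 => ->.
  rewrite rkT Fi0 cardsT card_ord -big_split; apply: eq_bigr => s _ /=.
  rewrite -mulrnDl -[X in _ + X]mulr1 -mulrDr; congr (_ * _ *+ _).
  have -> : (r - s = (r - s).-1.+1)%N by have := ltn_ord s; lia.
  rewrite /geom /= [RHS]big_ord_recl expr0 addrC mulr_sumr; congr (_ + _).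
  by apply: eq_bigr => a _; rewrite -exprS.
move=> j ji; have jT : F j != setT.
  by apply: contraTneq ji => ->; rewrite properE subsetT andbF.
rewrite std_top_gf //; last first.
  by move: (proper_card ji) (card_F_lt i0); clear; lia.
by have -> : rk (F j) = #|F j| by have := F_small F_flat jT; rewrite /urank; lia.
Qed.

End GeneratingFunction.

End CountStandard.

(** * The Chow ring of a uniform matroid *)

Section ChowRingProjection.
Variables (E : finType) (M : matroid E).
Local Notation proj := (@chow_proj E M).

Lemma chow_proj_eq0 p : proj p = 0 <-> chow_ideal p.
Proof.
have -> : chow_ideal p = (p \in chow_idealr M) by [].
rewrite -[in X in _ <-> X](subr0 p) Quotient.idealrBE.
have -> : 0 = proj 0 by rewrite /chow_proj raddf0.
by split=> [E0|/eqP//]; apply/eqP.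
Qed.

Lemma chow_proj_is_linear : linear proj.
Proof. by move=> a p q; rewrite chow_projD -mul_mpolyC chow_projM. Qed.
HB.instance Definition _ := GRing.isLinear.Build rat (chow_polyring M)
  (chow_ring M) *:%R proj chow_proj_is_linear.
HB.instance Definition _ := GRing.isMonoidMorphism.Build (chow_polyring M)
  (chow_ring M) proj (@chow_proj1 E M, @chow_projM E M).

Lemma chow_ideal_gen p :
  p \in linear_relations M ++ quadratic_relations M -> chow_ideal p.
Proof.
move=> ps; apply/asboolP; set s := _ ++ _ in ps *.
have lti : (index p s < size s)%N by rewrite index_mem.
exists (fun i => (i == Ordinal lti)%:R); rewrite (bigD1 (Ordinal lti)) //=.
rewrite eqxx mul1r nth_index // big1 ?addr0 // => i /negPf->.
by rewrite mul0r.
Qed.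

Lemma chow_linear_relation e : \sum_(i | e \in @chow_flat E M i) proj 'X_i = 0.
Proof.
rewrite -linear_sum; apply/chow_proj_eq0/chow_ideal_gen.
by rewrite mem_cat map_f ?mem_enum.
Qed.

Lemma chow_quadratic_relation i j :
  ~~ (@chow_flat E M i \subset chow_flat j) ->
  ~~ (@chow_flat E M j \subset chow_flat i) -> proj 'X_i * proj 'X_j = 0.
Proof.
move=> ij ji; rewrite -rmorphM; apply/chow_proj_eq0/chow_ideal_gen.
rewrite mem_cat; apply/orP; right; apply/mapP; exists (i, j) => //.
by rewrite mem_enum unfold_in /= /incomparable ij.
Qed.

End ChowRingProjection.

Section UniformChowRing.
Variables n r : nat.
Hypotheses (r_gt0 : (0 < r)%N) (r_le_n : (r <= n)%N).
Let M := uniform_matroid r n.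
Let F := @chow_flat _ M.
Local Notation proj := (@chow_proj _ M).

Lemma chow_flat_inj : injective F.
Proof. exact: enum_val_inj. Qed.

Lemma chow_flatP (A : {set 'I_n}) :
  (exists i, F i = A) <-> (A != set0) && ((A == setT) || (#|A| < r)%N).
Proof.
have -> : (A != set0) && ((A == setT) || (#|A| < r)%N) = (A \in nonempty_flats M).
  by rewrite in_setD1 /M /= inE.
split=> [[i <-]|AM]; first exact: enum_valP.
by exists (enum_rank_in AM A); apply: enum_rankK_in.
Qed.

Definition std_deg d := [seq m <- std_all r F | mdeg m == d].

Lemma std_deg_uniq d : uniq (std_deg d).
Proof. exact/filter_uniq/(std_all_uniq r chow_flat_inj). Qed.

Lemma mem_std_deg d m : (m \in std_deg d) = std r F m && (mdeg m == d).
Proof. by rewrite mem_filter andbC (mem_std_all r chow_flat_inj). Qed.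

Local Notation xgen := (fun i => 'X_i : chow_polyring M).
Local Notation mon := (upper_monomial F (fun i => proj 'X_i)).

Lemma proj_upper_monomial m : proj (upper_monomial F xgen m) = mon m.
Proof.
rewrite rmorph_prod; apply: eq_bigr => i _; rewrite rmorphXn; congr (_ ^+ _).
exact: linear_sum.
Qed.

Lemma upper_monomial_graded m : chow_graded (mdeg m) (mon m).
Proof.
exists (upper_monomial F xgen m); last by rewrite proj_upper_monomial.
have hom_h i : upper_sum F xgen (F i) \is 1.-homog.
  by apply: rpred_sum => j _; rewrite dhomogX; apply/eqP/mdeg1.
rewrite mdegE /upper_monomial; elim/big_rec2: _ => [|i d p _ IH].
  exact: dhomog1.
apply: dhomogM => //; have := dhomogMn (m i) (hom_h i).
by rewrite mul1n.
Qed.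

Lemma graded_std_span d v : chow_graded d v ->
  std_span F (fun i => proj 'X_i) std_deg d v.
Proof.
case=> p /dhomogP p_hom ->; rewrite {1}[p]mpolyE linear_sum.
rewrite big_seq; apply: std_span_sum => m /p_hom <-.
rewrite linearZ; apply: std_spanZ; rewrite mpolyXE_id rmorph_prod /=.
under eq_bigr do rewrite rmorphXn.
apply: (std_span_gen_monomial r_gt0 r_le_n chow_flat_inj chow_flatP).
- exact: chow_linear_relation.
- exact: chow_quadratic_relation.
- exact: std_deg_uniq.
exact: mem_std_deg.
Qed.

(** A relation in the Chow ring lifts to an element of the ideal, on which all pairings vanish. *)
Lemma std_independent d (c : 'X_{1..#|nonempty_flats M|} -> rat) :
  \sum_(m <- std_deg d) c m *: mon m = 0 -> forall m, m \in std_deg d -> c m = 0.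
Proof.
move=> c0; apply: (upper_monomials_independent r_gt0 r_le_n chow_flat_inj chow_flatP).
- exact: std_deg_uniq.
- by move=> m; rewrite mem_std_deg => /andP[].
move=> m0 sm0; set p := \sum_(m <- _) _.
have /asboolP[a ->] : chow_ideal (p : chow_polyring M).
  apply/chow_proj_eq0; rewrite -[RHS]c0 linear_sum; apply: eq_bigr => m _.
  by rewrite linearZ /= proj_upper_monomial.
rewrite linear_sum big1 // => i _ /=.
have := mem_nth 0 (ltn_ord i); rewrite mem_cat => /orP[/mapP[e _ ->]|/mapP[[j l]]].
  exact: (pairing_linear r_gt0 r_le_n chow_flat_inj chow_flatP sm0).
rewrite mem_enum unfold_in /= => /andP[jl lj] ->.
exact: (pairing_quadratic r_gt0 r_le_n chow_flat_inj chow_flatP sm0).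
Qed.

Lemma uniform_graded_dim d : has_dim (@chow_graded _ M d) (size (std_deg d)).
Proof.
pose b (i : 'I_(size (std_deg d))) := mon (nth 0%MM (std_deg d) i).
have sumE (c : 'X_{1..#|nonempty_flats M|} -> rat) :
    \sum_(m <- std_deg d) c m *: mon m =
    \sum_i (\row_i c (nth 0%MM (std_deg d) i)) 0 i *: b i.
  by rewrite (big_nth 0%MM) big_mkord; apply: eq_bigr => i _; rewrite mxE.
exists b; split=> [i|v /graded_std_span[c ->]].
  have := mem_nth 0%MM (ltn_ord i); rewrite mem_std_deg => /andP[_ /eqP <-].
  exact: upper_monomial_graded.
rewrite sumE; exists (\row_i c (nth 0%MM (std_deg d) i)); split=> // c' cc'.
(* The difference of the two coefficient families as a function on monomials; [c'] is extended by 0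
   outside [std_deg d]. *)
pose c2 m := c m - (if insub (index m (std_deg d)) is Some i then c' 0 i else 0).
have c2E (i : 'I_(size (std_deg d))) : 
    c2 (nth 0%MM (std_deg d) i) = c (nth 0%MM (std_deg d) i) - c' 0 i.
  by rewrite /c2 index_uniq ?std_deg_uniq ?ltn_ord // valK.
have c20 : \sum_(m <- std_deg d) c2 m *: mon m = 0.
  rewrite sumE -[RHS](subrr (\sum_i c' 0 i *: b i)) -{1}cc' -sumrB.
  by apply: eq_bigr => i _; rewrite !mxE c2E scalerBl.
apply/rowP => i; rewrite mxE; apply/eqP; rewrite -subr_eq0 -c2E; apply/eqP.
exact: (std_independent c20 (mem_nth 0%MM (ltn_ord i))).
Qed.

Lemma uniform_hilbert_series :
  is_hilbert_series M (\sum_(m <- std_all r F) 'X^(mdeg m)).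
Proof.
move=> d; rewrite coef_sum; under eq_bigr do rewrite coefXn.
have -> : \sum_(m <- std_all r F) ((d == mdeg m)%:R : nat) = size (std_deg d).
  rewrite size_filter -sum1_count [RHS]big_mkcond; apply: eq_bigr => m _.
  by rewrite eq_sym; case: eqP.
exact: uniform_graded_dim.
Qed.

End UniformChowRing.

(** The identity is proved over integer polynomials, an integral domain; comparing coefficients,
    which are counts, brings it back to natural numbers. *)
Lemma sum_polyXn_nat (I J : Type) (s : seq I) (P : pred I) (s' : seq J)
    (f : I -> nat) (g : J -> nat) :
  \sum_(i <- s | P i) 'X^(f i) = \sum_(j <- s') 'X^(g j) :> {poly int} ->
  \sum_(i <- s | P i) 'X^(f i) = \sum_(j <- s') 'X^(g j) :> {poly nat}.
Proof.
move=> E; apply/polyP => d; have := congr1 (fun p : {poly int} => p`_d) E.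
rewrite !coef_sum; under eq_bigr do rewrite coefXn.
under [in RHS]eq_bigr do rewrite coefXn.
rewrite -!natr_sum => /eqP; rewrite Num.Theory.eqr_nat => /eqP E'.
under eq_bigr do rewrite coefXn.
under [in RHS]eq_bigr do rewrite coefXn.
by rewrite -!natr_sum E'.
Qed.

Theorem corollary3p18 (n k : nat) (hn : (2 <= n)%N) (hk : (1 <= k <= n - 1)%N) :
  exists H : {poly nat},
    is_hilbert_series (uniform_matroid (n - k) n) H /\
    'X^k * H = \sum_(e in Dk n k) 'X^(asc [seq val x | x <- e]).
Proof.
have r_gt0 : (0 < n - k)%N by lia.
exists (\sum_(m <- std_all (n - k) (@chow_flat _ (uniform_matroid (n - k) n)))
  'X^(mdeg m)).
split; first exact: uniform_hilbert_series r_gt0 (leq_subr k n).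
case: n hn hk r_gt0 => // n hn hk r_gt0; case: k hk r_gt0 => // k hk r_gt0.
rewrite (sum_Dk n k.+1 (fun s => 'X^(asc s) : {poly nat})) mulr_sumr.
under eq_bigr do rewrite -exprD.
apply/esym/sum_polyXn_nat.
(* [asc_gfE] is used at t = X; [der_op] is injective there because t != 1. *)
have X1 : 'X != 1 :> {poly int}.
  by apply/eqP => /(congr1 (size \o polyseq)); rewrite /= size_polyX size_poly1.
rewrite -[LHS]/(asc_gf 'X k.+1 n.+1) asc_gfE //.
rewrite -(std_all_gf r_gt0 (leq_subr _ _) (@chow_flat_inj _ _) (@chow_flatP _ _)).
by rewrite mulr_sumr; apply: eq_bigr => m _; rewrite exprD.
Qed.
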